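(* For any real $\alpha>-1$ and any $N\in\mathbb{N}$, $$m_\alpha^{N+1}\,\Lambda_{\alpha,N}^{N+1}=m_\alpha^{N}.$$
   Context: $W_{\ge}^N=\{\mathbf{x}\in[0,\infty)^N: x_1\le\dots\le x_N\}$, $\mathring{W}_{\ge}^N=\{\mathbf{x}\in W_{\ge}^N: 0<x_1<\dots<x_N\}$. $m_\alpha^N$ (the Laguerre ensemble) is the probability measure on $W_{\ge}^N$ given by $$m_\alpha^N(d\mathbf{x})=\frac{1}{Z_{N,\alpha}}\prod_{1\le i<j\le N}(x_i-x_j)^2\prod_{k=1}^N x_k^\alpha e^{-x_k}\,d\mathbf{x},$$ with $Z_{N,\alpha}$ the normalizing constant. For a probability measure $\mu$ on $E$ and a Markov kernel $\Lambda$ from $E$ to $E'$, $\mu\Lambda(\cdot)=\int_E\Lambda(x,\cdot)\,\mu(dx)$. Let $\Delta_N(\mathbf{y})=\prod_{1\le i<j\le N}(y_j-y_i)$ and $(x)_n=x(x+1)\cdots(x+n-1)$. For $\mathbf{x}\in\mathring{W}_{\ge}^{N+1}$, $\Lambda_{\alpha,N}^{N+1}(\mathbf{x},\cdot)$ is the measure on $W_{\ge}^N$ given by $$\Lambda_{\alpha,N}^{N+1}(\mathbf{x},d\mathbf{y})=N!\,(\alpha+1)_N\frac{\Delta_N(\mathbf{y})}{\Delta_{N+1}(\mathbf{x})}\prod_{k=1}^N\bigg(\mathbf{1}_{[x_{k-1},x_{k+1}]}(y_k)\int_{x_k\vee y_k}^{x_{k+1}\wedge y_{k+1}}\frac{y_k^\alpha}{z^{\alpha+1}}\,dz\bigg)d\mathbf{y},$$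 with the conventions $x_0=0$ and $y_{N+1}=\infty$. For $\mathbf{x}\in W_{\ge}^{N+1}\setminus\mathring{W}_{\ge}^{N+1}$, $\Lambda_{\alpha,N}^{N+1}(\mathbf{x},\cdot)$ is defined as the weak limit of $\Lambda_{\alpha,N}^{N+1}(\mathbf{x}^n,\cdot)$ along any sequence $\mathbf{x}^n\in\mathring{W}_{\ge}^{N+1}$ with $\mathbf{x}^n\to\mathbf{x}$ (the limit exists and does not depend on the sequence); this makes $\Lambda_{\alpha,N}^{N+1}$ a Markov kernel from $W_{\ge}^{N+1}$ to $W_{\ge}^N$. *)

(* Defs.v *)
From HB Require Import structures.
From mathcomp Require Import all_boot all_order all_algebra.
From mathcomp Require Import all_classical all_reals all_analysis.
From mathcomp Require Import measurable_realfun.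

Set Implicit Arguments.
Unset Strict Implicit.
Unset Printing Implicit Defensive.

Import Order.TTheory GRing.Theory Num.Theory.
Import numFieldNormedType.Exports.

Local Open Scope classical_set_scope.
Local Open Scope ring_scope.

(* Points of R^n are n-tuples, with the library's product sigma-algebra (the Borel
   one). MathComp-Analysis has no topology on tuples: we transport the one of
   row vectors, so convergence is coordinatewise. *)
Definition row_of_tuple n (T : Type) (x : n.-tuple T) : 'rV[T]_n :=
  \row_i tnth x i.

HB.instance Definition _ n (T : topologicalType) :=
  Topological.copy (n.-tuple T) (initial_topology (@row_of_tuple n T)).

Section lebesgue_step.
Context {R : realType} (n : nat).
Variable mu : {sigma_finite_measure set (n.-tuple R) -> \bar R}.

Definition consp (p : measurableTypeR R * n.-tuple R) : n.+1.-tuple R :=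
  [tuple of p.1 :: p.2].

Lemma measurable_consp : measurable_fun setT consp.
Proof.
by apply: measurable_cons; [exact: measurable_fst|exact: measurable_snd].
Qed.

Definition lebesgue_step : set (n.+1.-tuple R) -> \bar R :=
  pushforward (@lebesgue_measure R \x mu)%E consp.

Let lebesgue_step0 : lebesgue_step set0 = 0%E.
Proof. by rewrite /lebesgue_step /pushforward preimage_set0 measure0. Qed.

Let lebesgue_step_ge0 A : (0 <= lebesgue_step A)%E.
Proof. by rewrite /lebesgue_step /pushforward. Qed.

Let lebesgue_step_sigma_additive : semi_sigma_additive lebesgue_step.
Proof.
unshelve refine (@measure_semi_sigma_additive _ _ _
  (pushforward (@lebesgue_measure R \x mu)%E consp)).
exact: measurable_consp.
Qed.
HB.instance Definition _ := isMeasure.Build _ _ _ lebesgue_step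
  lebesgue_step0 lebesgue_step_ge0 lebesgue_step_sigma_additive.

Let lebesgue_step_sigma_finite : sigma_finite setT lebesgue_step.
Proof.
have /sigma_finiteP[F [TF ndF Foo]] := sigma_finiteT (@lebesgue_measure R).
have /sigma_finiteP[G [TG ndG Goo]] := sigma_finiteT mu.
pose uc (x : n.+1.-tuple R) : measurableTypeR R * n.-tuple R :=
  (thead x, [tuple of behead x]).
have ucK p : uc (consp p) = p.
  by case: p => a b; rewrite /uc /consp/= theadE; congr pair; exact/val_inj.
have cuK x : consp (uc x) = x by rewrite /uc /consp /= -tuple_eta.
have muc : measurable_fun setT uc.
  apply/measurable_fun_pairP; split.
    exact: (measurable_tnth (ord0 : 'I_n.+1)).
  exact: measurable_behead.
exists (fun i => uc @^-1` (F i `*` G i)).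
  apply/esym; rewrite -subTset => x _.
  have [i _ Fi] : (\bigcup_i F i) (uc x).1 by rewrite -TF.
  have [j _ Gj] : (\bigcup_i G i) (uc x).2 by rewrite -TG.
  exists (maxn i j) => //; split => /=.
  - by move: Fi; apply/subsetPset/ndF/leq_maxl.
  - by move: Gj; apply/subsetPset/ndG/leq_maxr.
move=> i; have [mF Fi] := Foo i; have [mG Gi] := Goo i; split.
  by rewrite -[X in measurable X]setTI; apply: muc => //; exact: measurableX.
rewrite /lebesgue_step /pushforward -comp_preimage.
rewrite (_ : _ \o _ = id) ?preimage_id; last by apply/funext => p; exact: ucK.
by rewrite product_measure1E// lte_mul_pinfty// ge0_fin_numE.
Qed.
HB.instance Definition _ := Measure_isSigmaFinite.Build _ _ _ lebesgue_step
  lebesgue_step_sigma_finite.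

End lebesgue_step.

(* Lebesgue measure on R^n: the unit mass on R^0, then the product with the
   one-dimensional measure, one coordinate at a time. *)
Fixpoint lebesgue_tuple (R : realType) (n : nat) :
    {sigma_finite_measure set (n.-tuple R) -> \bar R} :=
  match n return {sigma_finite_measure set (n.-tuple R) -> \bar R} with
  | 0 => \d_ [tuple]
  | n'.+1 => lebesgue_step (lebesgue_tuple R n')
  end.

Unset Implicit Arguments.

Section chamber.
Context {R : realType}.

(* [path <=%R 0 x] is 0 <= x_1 <= ... <= x_N. *)
Definition chamber (N : nat) : set (N.-tuple R) := [set x | path <=%R 0 x].
Definition open_chamber (N : nat) : set (N.-tuple R) := [set x | path <%R 0 x].

Lemma measurable_chamber N : measurable (chamber N).
Proof.
have mnth (i : 'I_N) : measurable_fun setT (fun x : N.-tuple R => (0 :: x)`_i).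
  case: i => [[|i] iN]/=; first exact: measurable_cst.
  rewrite (_ : (fun _ => _) = (@tnth _ _ ^~ (Ordinal (ltnW iN)))).
    exact: measurable_tnth.
  by apply/funext => x; rewrite (tnth_nth 0).
rewrite (_ : chamber N = \big[setI/setT]_(i < N)
    [set x : N.-tuple R | (0 :: x)`_i <= tnth x i]); last first.
  apply/seteqP; split => x /=.
    move/(pathP 0) => h; rewrite -bigcap_seq => i _ /=.
    by rewrite (tnth_nth 0); apply: h; rewrite size_tuple.
  rewrite -bigcap_seq => h; apply/(pathP 0) => i; rewrite size_tuple => iN.
  by have := h (Ordinal iN) (mem_index_enum _); rewrite /= (tnth_nth 0).
apply: bigsetI_measurable => i _.
rewrite -[X in measurable X]setTI; apply: measurable_fun_le => //.
exact: measurable_tnth.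
Qed.

End chamber.

Section laguerre.
Context {R : realType}.

(* The measures m, m Lambda and Lambda(x, .) on the chamber are represented as
   measures on the whole of R^N that do not charge its complement. *)
Definition laguerre_weight (alpha : R) N (x : N.-tuple R) : R :=
  (\prod_(i < N) \prod_(j < N | (i < j)%N) (tnth x i - tnth x j) ^+ 2) *
  \prod_(k < N) (tnth x k `^ alpha * expR (- tnth x k)).

Definition laguerre_Z (alpha : R) N : \bar R :=
  \int[lebesgue_tuple R N]_(x in chamber N) (laguerre_weight alpha N x)%:E.

Definition laguerre (alpha : R) N (A : set (N.-tuple R)) : \bar R :=
  \int[lebesgue_tuple R N]_(x in A `&` chamber N)
    ((fine (laguerre_Z alpha N))^-1 * laguerre_weight alpha N x)%:E.

Lemma laguerre_weight_ge0 alpha N (x : N.-tuple R) :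
  0 <= laguerre_weight alpha N x.
Proof.
apply: mulr_ge0; apply: prodr_ge0 => i _.
  by apply: prodr_ge0 => j _; exact: sqr_ge0.
by rewrite mulr_ge0// ?powR_ge0 ?expR_ge0.
Qed.

Lemma measurable_laguerre_weight alpha N :
  measurable_fun setT (laguerre_weight alpha N).
Proof.
apply: measurable_funM; apply: measurable_prod => i _ /=.
  under eq_fun do rewrite big_mkcond/=.
  apply: measurable_prod => j _; case: (i < j)%N; last exact: measurable_cst.
  apply: measurable_funX.
  by apply: measurable_funB; exact: measurable_tnth.
apply: measurable_funM.
  by apply: (measurableT_comp (measurable_powR _)); exact: measurable_tnth.
apply: (measurableT_comp (f := expR) (g := fun x : N.-tuple R => - tnth x i)).
  exact: measurable_expR.
by apply: measurable_funN; exact: measurable_tnth.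
Qed.

Section laguerre_measure.
Variables (alpha : R) (N : nat).

Let density_ge0 (x : N.-tuple R) :
  (0 <= ((fine (laguerre_Z alpha N))^-1 * laguerre_weight alpha N x)%:E)%E.
Proof.
rewrite lee_fin mulr_ge0 ?laguerre_weight_ge0// invr_ge0 fine_ge0//.
by apply: integral_ge0 => y _; rewrite lee_fin laguerre_weight_ge0.
Qed.

Let laguerre0 : laguerre alpha N set0 = 0%E :> \bar R.
Proof. by rewrite /laguerre set0I integral_set0. Qed.

Let laguerre_ge0 A : (0 <= laguerre alpha N A)%E.
Proof. by apply: integral_ge0 => x _; exact: density_ge0. Qed.

Let laguerre_sigma_additive : semi_sigma_additive (laguerre alpha N).
Proof.
move=> F mF tF mUF; rewrite /laguerre setI_bigcupl.
rewrite ge0_integral_bigcup//; first last.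
- by apply/trivIset_setIr.
- apply: measurable_funTS; apply/measurable_EFinP.
  by apply: measurable_funM => //; exact: measurable_laguerre_weight.
- by move=> i; apply: measurableI => //; exact: measurable_chamber.
by apply: is_cvg_ereal_nneg_natsum => n _; exact: laguerre_ge0.
Qed.

HB.instance Definition _ := isMeasure.Build _ _ _ (laguerre alpha N)
  laguerre0 laguerre_ge0 laguerre_sigma_additive.

End laguerre_measure.

End laguerre.

Section Lambda.
Context {R : realType}.

Definition vandermonde {n} (x : n.-tuple R) : R :=
  \prod_(i < n) \prod_(j < n | (i < j)%N) (tnth x j - tnth x i).

Definition pochhammer (x : R) (n : nat) : R := \prod_(i < n) (x + i%:R).

(* Coordinates numbered from 1, with x_0 = 0; in the extended version, every
   coordinate beyond the last one is +oo. *)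
Definition coord {n} (x : n.-tuple R) (k : nat) : R := (0 :: x)`_k.
Definition ecoord {n} (x : n.-tuple R) (k : nat) : \bar R :=
  nth +oo%E [seq t%:E | t <- 0 :: x] k.

Definition Lambda_density (alpha : R) N (x : N.+1.-tuple R) (y : N.-tuple R) :
    R :=
  N`!%:R * pochhammer (alpha + 1) N * (vandermonde y / vandermonde x) *
  \prod_(1 <= k < N.+1)
    (\1_`[coord x k.-1, coord x k.+1]%classic (coord y k) *
     \int[lebesgue_measure]_(z in [set z : R |
         (maxe (ecoord x k) (ecoord y k) <= z%:E
            <= mine (ecoord x k.+1) (ecoord y k.+1))%E])
       (coord y k `^ alpha / z `^ (alpha + 1))).

Definition Lambda_open (alpha : R) N (x : N.+1.-tuple R) (A : set (N.-tuple R)) :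
    \bar R :=
  \int[lebesgue_tuple R N]_(y in A `&` chamber N) (Lambda_density alpha N x y)%:E.

(* Weak convergence on the chamber: the test functions are the bounded functions
   that are continuous on it. *)
Definition weak_cvg N (nu : nat -> set (N.-tuple R) -> \bar R)
    (mu : set (N.-tuple R) -> \bar R) : Prop :=
  forall f : N.-tuple R -> R,
    {within chamber N, continuous f} ->
    (exists M : R, forall y, chamber N y -> `|f y| <= M) ->
    (\int[nu n]_(y in chamber N) (f y)%:E)%E @[n --> \oo] -->
    (\int[mu]_(y in chamber N) (f y)%:E)%E.

Definition is_Lambda_limit (alpha : R) N (x : N.+1.-tuple R)
    (mu : probability (N.-tuple R) R) : Prop :=
  mu (chamber N) = 1%E /\
  forall u : nat -> N.+1.-tuple R,
    (forall n, open_chamber N.+1 (u n)) -> u n @[n --> \oo] --> x ->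
    weak_cvg N (fun n => Lambda_open alpha N (u n)) mu.

(* On the boundary of the chamber, the weak limit along every sequence of the open
   chamber is selected by choice. The default 0 only serves to make the definition
   total, and the values outside the chamber are irrelevant. *)
Definition Lambda (alpha : R) N (x : N.+1.-tuple R) (A : set (N.-tuple R)) :
    \bar R :=
  if path <%R 0 x then Lambda_open alpha N x A
  else if pselect (exists mu, is_Lambda_limit alpha N x mu) is left ex
  then projT1 (cid ex) A else 0%E.

End Lambda.

Definition mul_kernel {R : realType} {M N : nat} (mu : set (M.-tuple R) -> \bar R)
    (K : M.-tuple R -> set (N.-tuple R) -> \bar R) (A : set (N.-tuple R)) :
    \bar R :=
  \int[mu]_(x in chamber M) K x A.

(* Main.v *)
Require Import Defs.
From mathcomp Require Import all_boot all_order all_algebra perm.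
From mathcomp Require Import all_classical all_reals all_analysis.
From mathcomp Require Import measurable_realfun ring lra.

Set Implicit Arguments.
Unset Strict Implicit.
Unset Printing Implicit Defensive.

Import Order.TTheory GRing.Theory Num.Theory.
Import numFieldNormedType.Exports.
Local Open Scope classical_set_scope.
Local Open Scope ring_scope.

(** Write Delta for the Vandermonde product and number coordinates from 1. The
    idea is that the kernel factors through an intermediate vector z of length
    N. The product over k of the one-dimensional integrals in its density is
    one integral over z, namely of prod_k y_k^alpha z_k^-(alpha+1) over the z
    that interlace both with x (x_k <= z_k <= x_{k+1}) and with y
    (y_k <= z_k <= y_{k+1}, with y_{N+1} = +oo); the indicators
    x_{k-1} <= y_k <= x_{k+1} hold as soon as such a z exists
    ([Lambda_prodE]).

    Up to null sets, the interlacing conditions say that, given z, the vector x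
    (or y) ranges over a product of consecutive intervals with endpoints in
    0, z_1, ..., z_N, +oo, and that, given x (or y), so does z with endpoints
    in x (or y). Over a product of intervals I_i, the integral of
    det [f_j (t_i)] is det [int_(I_i) f_j]. Since the Vandermonde determinant
    may be written with any monic polynomials p_j, the p_j are chosen so that
    p_j times the weight has an explicit primitive (only p_0 in the first
    formula below has none, and contributes the constant
    G = int_0^oo t^alpha e^-t dt); the rows of the integrated matrix are then
    differences of consecutive values of these primitives, and the determinant
    is again a Vandermonde one. This gives
     - int Delta(x) prod x_i^alpha e^-x_i dx
       = G Delta(z) prod z_i^(alpha+1) e^-z_i        (x given z),
     - int Delta(z) prod e^-z_i dz = Delta(y) prod e^-y_i   (z given y),
     - int Delta(y) prod y_i^alpha dy
       = Delta(z) prod z_i^(alpha+1) / (alpha+1)_N   (y given z),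
     - int Delta(z) dz = Delta(x) / N!               (z given x);
    these are [integral_interlaced_gamma], [integral_interlaced_expR],
    [integral_interlaced_powR] and [integral_interlaced_vandermonde].

    Multiplying the kernel by the Laguerre weight w_{N+1}(x) =
    Delta(x)^2 prod x_i^alpha e^-x_i cancels the denominator Delta(x). By
    Tonelli and the first two formulas, integrating x and then z out leaves
    N! (alpha+1)_N G w_N(y), so the image of the Laguerre ensemble is
    proportional to the Laguerre ensemble. The last two formulas say that the
    kernel is Markov, so comparing total masses gives
    Z_{N+1} = N! (alpha+1)_N G Z_N ([laguerre_Z_rec]); this identifies the
    constant and shows by induction that 0 < Z_N < +oo. The boundary of the
    chamber, where the kernel is only defined as a weak limit, is a null set
    ([lebesgue_tuple_not_uniq]). *)

(** * Determinants of bidiagonal modifications *)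

Section determinants.
Context {F : comRingType}.

(** Replacing the monomial X^j by the monic polynomial X^j - c_j X^(j-1) multiplies
    the Vandermonde matrix by a unipotent one. *)
Lemma det_bidiag_vandermonde n (c : nat -> F) (x : 'I_n -> F) : c 0 = 0 ->
  \det (\matrix_(i, j < n) (x i ^+ j - c j * x i ^+ j.-1)) =
  \prod_(i < n) \prod_(j < n | (i < j)%N) (x j - x i).
Proof.
move=> c0.
(* column j of T holds the coefficients of X^j - c_j X^(j-1) *)
pose T : 'M[F]_n := \matrix_(k, j) ((k == j)%:R - c j * (k.+1 == j)%:R).
have detT : \det T = 1.
  rewrite -det_tr det_trig; last first.
    apply/is_trig_mxP => i j ij; rewrite !mxE.
    by rewrite -val_eqE /= (gtn_eqF ij) (gtn_eqF (leqW ij)) mulr0 subr0.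
  by apply: big1 => i _; rewrite !mxE eqxx gtn_eqF// mulr0 subr0.
transitivity (\det ((Vandermonde n (\row_j x j))^T *m T)); last first.
  rewrite det_mulmx detT mulr1 det_tr det_Vandermonde.
  by apply: eq_bigr => i _; apply: eq_bigr => j _; rewrite !mxE.
congr (\det _); apply/matrixP => i j; rewrite !mxE.
under eq_bigr do rewrite !mxE mulrBr.
rewrite sumrB (bigD1 j)//= eqxx mulr1 big1 ?addr0; last first.
  by move=> k /negbTE ->; rewrite mulr0.
congr (_ - _); case: j => -[|j] jn /=.
  by rewrite c0 mul0r big1// => k _; rewrite !mulr0.
rewrite (bigD1 (Ordinal (ltnW jn)))//= eqxx mulr1 mulrC big1 ?addr0//.
move=> k; rewrite -val_eqE /= eqSS => /negbTE ->.
by rewrite !mulr0.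
Qed.

(** Subtracting from each row the previous one is multiplication by a unipotent
    lower bidiagonal matrix. *)
Lemma det_row_diff n (A : nat -> 'I_n -> F) :
  \det (\matrix_(i, j < n) (A i j - (if (i : nat) is 0 then 0 else A i.-1 j))) =
  \det (\matrix_(i, j < n) A i j).
Proof.
pose L : 'M[F]_n := \matrix_(i, k) ((i == k)%:R - ((i : nat) == k.+1)%:R).
have detL : \det L = 1.
  rewrite det_trig; last first.
    apply/is_trig_mxP => i j ij; rewrite !mxE.
    by rewrite -val_eqE /= (ltn_eqF ij) (ltn_eqF (leqW ij)) subr0.
  by apply: big1 => i _; rewrite !mxE eqxx ltn_eqF// subr0.
rewrite -[RHS]mul1r -detL -det_mulmx; congr (\det _).
apply/matrixP => i j; rewrite !mxE.
under eq_bigr do rewrite !mxE mulrBl.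
rewrite sumrB (bigD1 i)//= eqxx mul1r big1 ?addr0; last first.
  by move=> k ki; rewrite eq_sym (negbTE ki) mul0r.
congr (_ - _); case: i => -[|i] ni /=.
  by rewrite big1// => k _; rewrite mul0r.
rewrite (bigD1 (Ordinal (ltnW ni)))//= eqxx mul1r big1 ?addr0//.
by move=> k; rewrite -val_eqE /= eqSS eq_sym => /negbTE ->; rewrite mul0r.
Qed.

(** For boxes whose first interval starts at 0, where the primitives vanish. *)
Lemma det_row_diff0 n (D : nat -> 'I_n -> F) : (forall j, D 0 j = 0) ->
  \det (\matrix_(i, j < n) (D i.+1 j - D i j)) =
  \det (\matrix_(i, j < n) D i.+1 j).
Proof.
move=> D0; rewrite -(det_row_diff (fun i => D i.+1)); congr (\det _).
by apply/matrixP => -[[|i] ni] j; rewrite !mxE//= D0.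
Qed.

(** For boxes whose last interval extends to +oo, with D the integrals over the
    right tails. *)
Lemma det_row_diffn n (D : nat -> 'I_n -> F) : (forall j, D n j = 0) ->
  \det (\matrix_(i, j < n) (D i j - D i.+1 j)) =
  \det (\matrix_(i, j < n) D i j).
Proof.
move=> Dn.
pose U : 'M[F]_n := \matrix_(i, k) ((i == k)%:R - (i.+1 == k)%:R).
have detU : \det U = 1.
  rewrite -det_tr det_trig; last first.
    apply/is_trig_mxP => i j ij; rewrite !mxE.
    by rewrite -val_eqE /= (gtn_eqF ij) (gtn_eqF (leqW ij)) subr0.
  by apply: big1 => i _; rewrite !mxE eqxx gtn_eqF// subr0.
rewrite -[RHS]mul1r -detU -det_mulmx; congr (\det _).
apply/matrixP => i j; rewrite !mxE.
under eq_bigr do rewrite !mxE mulrBl.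
rewrite sumrB (bigD1 i)//= eqxx mul1r big1 ?addr0; last first.
  by move=> k ki; rewrite eq_sym (negbTE ki) mul0r.
congr (_ - _); have [ni|ni] := ltnP i.+1 n.
  rewrite (bigD1 (Ordinal ni))//= eqxx mul1r big1 ?addr0//.
  by move=> k; rewrite -val_eqE /= eq_sym => /negbTE ->; rewrite mul0r.
have -> : i.+1 = n by apply/eqP; rewrite eqn_leq ni andbT.
by rewrite Dn big1// => k _; rewrite gtn_eqF// mul0r.
Qed.

(** For n intervals delimited by n + 1 points: the bordered determinant on the
    right is a Vandermonde-like determinant in all n + 1 points. *)
Lemma det_row_diff_border n (D : nat -> nat -> F) :
  \det (\matrix_(i, j < n) (D i.+1 j - D i j)) =
  \det (\matrix_(i, j < n.+1) if (j : nat) is 0 then 1 else D i j.-1).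
Proof.
rewrite -(det_row_diff
  (fun i (j : 'I_n.+1) => if (j : nat) is 0 then 1 else D i j.-1)).
rewrite [RHS](expand_det_col _ ord0) big_ord_recl !mxE /= subr0 mul1r.
rewrite big1 ?addr0; last by move=> i _; rewrite !mxE subrr mul0r.
rewrite /cofactor expr0 mul1r; congr (\det _).
by apply/matrixP => i j; rewrite !mxE.
Qed.

Lemma det_last_row n (A : nat -> nat -> F) :
  (forall j, (j < n)%N -> A n j.+1 = 0) ->
  \det (\matrix_(i, j < n.+1) A i j) =
  A n 0%N * ((-1) ^+ n * \det (\matrix_(i, j < n) A i j.+1)).
Proof.
move=> A0; rewrite (expand_det_row _ ord_max) big_ord_recl !mxE /=.
rewrite big1 ?addr0; last by move=> j _; rewrite !mxE /= A0// mul0r.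
rewrite /cofactor addn0; congr (_ * (_ * \det _)).
by apply/matrixP => i j; rewrite !mxE /= /bump leqNgt ltn_ord.
Qed.

Lemma det_scale n (r : 'I_n -> F) (c : 'I_n -> F) (A : 'I_n -> 'I_n -> F) :
  \det (\matrix_(i, j) (r i * A i j * c j)) =
  \prod_i r i * \det (\matrix_(i, j) A i j) * \prod_j c j.
Proof.
transitivity (\det (diag_mx (\row_i r i) *m (\matrix_(i, j) A i j) *m
                    diag_mx (\row_i c i))).
  congr (\det _); apply/matrixP => i j.
  by rewrite mul_mx_diag mul_diag_mx !mxE.
rewrite !det_mulmx !det_diag; congr (_ * _ * _);
  by apply: eq_bigr => i _; rewrite mxE.
Qed.

End determinants.

(** * One-dimensional integrals *)

Section improper.
Context {R : realType}.
Local Notation lam := (@lebesgue_measure R).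

Lemma FTC2_pos (f F : R -> R) (a b : R) : 0 < a -> a < b ->
  (forall x : R, 0 < x -> {for x, continuous f}) ->
  (forall x : R, 0 < x -> is_derive x 1 F (f x)) ->
  (\int[lam]_(t in `[a, b]) (f t)%:E = (F b - F a)%:E)%E.
Proof.
move=> a0 ab cf dF; rewrite (@continuous_FTC2 _ f F)//.
- apply: continuous_in_subspaceT => x; rewrite inE /= in_itv/= => /andP[ax _].
  exact/cf/(lt_le_trans a0).
- have cF (x : R) : 0 < x -> {for x, continuous F}.
    move=> x0; apply/differentiable_continuous/derivable1_diffP.
    by have [] := dF _ x0.
  split.
  + move=> x; rewrite in_itv/= => /andP[ax _].
    by have [] := dF _ (lt_trans a0 ax).
  + by apply: cvg_at_right_filter; exact: cF.
  + by apply: cvg_at_left_filter; apply: cF; exact: lt_trans ab.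
- move=> x; rewrite in_itv/= => /andP[ax _].
  by rewrite derive1E; have [_] := dF _ (lt_trans a0 ax).
Qed.

(** Monotone convergence of the domain, applied to the positive and negative
    parts. *)
Lemma integrable_nondecreasing_cvg (E : (set R)^nat) (f : R -> R) :
  nondecreasing_seq E -> (forall n, measurable (E n)) ->
  lam.-integrable (\bigcup_n E n) (EFin \o f) ->
  (\int[lam]_(t in E n) (f t)%:E @[n --> \oo] -->
   \int[lam]_(t in \bigcup_n E n) (f t)%:E)%E.
Proof.
move=> ndE mE intf.
have mU : measurable (\bigcup_n E n) by exact: bigcup_measurable.
have mf := measurable_int _ intf.
have mEf n : measurable_fun (E n) (EFin \o f).
  by apply: measurable_funS mf => //; exact: bigcup_sup.
rewrite [X in _ --> X]integralE; under eq_fun do rewrite integralE.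
have p : (\int[lam]_(t in E n) (EFin \o f)^\+ t @[n --> \oo] -->
    \int[lam]_(t in \bigcup_n E n) (EFin \o f)^\+ t)%E.
  apply: ge0_nondecreasing_set_cvg_integral => //.
  by move=> n; exact: (measurable_funepos (mEf n)).
have m : (\int[lam]_(t in E n) (EFin \o f)^\- t @[n --> \oo] -->
    \int[lam]_(t in \bigcup_n E n) (EFin \o f)^\- t)%E.
  apply: ge0_nondecreasing_set_cvg_integral => //.
  by move=> n; exact: (measurable_funeneg (mEf n)).
apply: cvgeB => //; apply: fin_num_adde_defr.
exact: integrable_pos_fin_num.
Qed.

Variables (f F : R -> R) (D : set R) (a b : nat -> R) (l0 l1 : R).
Hypothesis a0 : forall n, 0 < a n.
Hypothesis ab : forall n, a n < b n.
Hypothesis nd : nondecreasing_seq (fun n => `[a n, b n]%classic).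
Hypothesis DE : D = \bigcup_n `[a n, b n]%classic.
Hypothesis cf : forall x : R, 0 < x -> {for x, continuous f}.
Hypothesis dF : forall x : R, 0 < x -> is_derive x 1 F (f x).
Hypothesis Fa : F (a n) @[n --> \oo] --> l0.
Hypothesis Fb : F (b n) @[n --> \oo] --> l1.

Let Fab : (\int[lam]_(t in `[a n, b n]) (f t)%:E @[n --> \oo] -->
  (l1 - l0)%:E)%E.
Proof.
under eq_fun do rewrite (FTC2_pos _ _ cf dF)//.
by apply: cvg_EFin; [exact: nearW|exact: cvgB].
Qed.

(** Reaches endpoints where F or f is singular (0 for negative powers, +oo) by
    exhausting D with compact segments. For f >= 0 integrability need not be
    known beforehand, so that this form also yields integrability. *)
Lemma ge0_FTC2_improper : (forall x, 0 < x -> 0 <= f x) ->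
  (\int[lam]_(t in D) (f t)%:E = (l1 - l0)%:E)%E.
Proof.
move=> f0; apply/esym/(cvg_unique _ Fab) => //; rewrite DE.
have pos n x : `[a n, b n]%classic x -> 0 < x.
  by rewrite /= in_itv/= => /andP[ax _]; exact: lt_le_trans ax.
apply: ge0_nondecreasing_set_cvg_integral => // n.
- apply/measurable_EFinP; apply: subspace_continuous_measurable_fun => //.
  apply: continuous_in_subspaceT => x /set_mem xab.
  exact: cf (pos _ _ xab).
- by move=> x /pos x0; rewrite lee_fin f0.
Qed.

Lemma integrable_FTC2_improper : lam.-integrable D (EFin \o f) ->
  (\int[lam]_(t in D) (f t)%:E = (l1 - l0)%:E)%E.
Proof.
rewrite DE => intf; apply/esym/(cvg_unique _ Fab) => //.
exact: integrable_nondecreasing_cvg.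
Qed.

End improper.

Section exhaustion.
Context {R : realType}.

Lemma itv0y_bigcup : `]0, +oo[%classic =
  \bigcup_n `[(n.+2%:R)^-1, n.+1%:R]%classic :> set R.
Proof.
apply/seteqP; split => x /=.
  rewrite in_itv/= andbT => x0.
  have [n Hn] : exists n : nat, x^-1 + x < n%:R.
    exists (Num.bound (x^-1 + x)); apply: archi_boundP.
    by rewrite addr_ge0// ?invr_ge0 ltW.
  exists n => //=; rewrite in_itv/=; apply/andP; split.
    rewrite invf_ple ?posrE ?ltr0n//.
    rewrite (@le_trans _ _ n%:R)// ?ler_nat ?leqW//.
    by rewrite (le_trans _ (ltW Hn))// lerDl ltW.
  rewrite (@le_trans _ _ n%:R)// ?ler_nat//.
  by rewrite (le_trans _ (ltW Hn))// lerDr invr_ge0 ltW.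
move=> [n _] /=; rewrite !in_itv/= andbT => /andP[nx _].
by rewrite (lt_le_trans _ nx)// invr_gt0.
Qed.

Lemma itv0b_bigcup (b : R) : 0 < b -> `]0, b]%classic =
  \bigcup_n `[b / n.+2%:R, b]%classic :> set R.
Proof.
move=> b0; apply/seteqP; split => x /=.
  rewrite in_itv/= => /andP[x0 xb].
  have [n Hn] : exists n : nat, b / x < n%:R.
    exists (Num.bound (b / x)); apply: archi_boundP.
    by rewrite divr_ge0 ?ltW.
  exists n => //=; rewrite in_itv/= xb andbT.
  rewrite ler_pdivrMr ?ltr0n// mulrC -ler_pdivrMr//.
  by rewrite (le_trans (ltW Hn))// ler_nat leqW.
move=> [n _] /=; rewrite !in_itv/= => /andP[nx ->]; rewrite andbT.
by rewrite (lt_le_trans _ nx)// divr_gt0.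
Qed.

Lemma cvgn_at_right0 (a : nat -> R) : (forall n, 0 < a n) ->
  a n @[n --> \oo] --> 0 -> a n @[n --> \oo] --> 0^'+.
Proof.
move=> a0 cva A /= /cva; rewrite !near_simpl; apply: filterS => n; apply.
exact: a0.
Qed.

Lemma cvgn_invS2 (b : R) : b / n.+2%:R @[n --> \oo] --> 0.
Proof.
rewrite -[X in _ --> X](mulr0 b); apply: cvgMl_tmp.
rewrite (_ : (fun _ => _) = [sequence @harmonic R n.+1]_n)//.
by rewrite cvg_shiftS; exact: cvg_harmonic.
Qed.

Lemma cvgn_natSy : (n.+1%:R : R) @[n --> \oo] --> +oo.
Proof.
by rewrite (cvg_shiftS (fun n => n%:R : R)); exact: cvgr_idn.
Qed.

End exhaustion.

Section gamma.
Context {R : realType}.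
Local Notation lam := (@lebesgue_measure R).

Lemma continuous_powR_pos (g x : R) : 0 < x ->
  {for x, continuous (fun t : R => t `^ g)}.
Proof.
move=> x0; apply/differentiable_continuous/derivable1_diffP.
by apply: derivable_powR; rewrite in_itv/= x0.
Qed.

Lemma integral_powR (g b : R) : -1 < g -> 0 < b ->
  (\int[lam]_(t in `]0%R, b]) (t `^ g)%:E = (b `^ (g + 1) / (g + 1))%:E)%E.
Proof.
move=> g1 b0; have g10 : 0 < g + 1 by rewrite -ltrBlDr sub0r.
rewrite -[in RHS](subr0 (b `^ (g + 1) / (g + 1))).
apply: (@ge0_FTC2_improper _ _ (fun t => t `^ (g + 1) / (g + 1)) _
   (fun n => b / n.+2%:R) (fun=> b)).
- by move=> n; rewrite divr_gt0.
- by move=> n; rewrite ltr_pdivrMr ?ltr0n// ltr_pMr// ltr1n.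
- apply/nondecreasing_seqP => n; rewrite subsetEset => x /=.
  rewrite !in_itv/= => /andP[nx ->]; rewrite andbT (le_trans _ nx)//.
  by rewrite ler_pM2l// lef_pV2 ?posrE ?ltr0n// ler_nat.
- exact: itv0b_bigcup.
- by move=> x x0; exact: continuous_powR_pos.
- move=> x x0; have := @is_derive1_powR _ (g + 1) x x0; rewrite addrK => H.
  rewrite (_ : (fun _ => _) = (g + 1)^-1 \*: (@powR R ^~ (g + 1))); last first.
    by apply/funext => t; rewrite /= mulrC.
  rewrite [X in is_derive _ _ _ X](_ : _ =
    (g + 1)^-1 *: ((g + 1) * x `^ g)); last first.
    by rewrite /GRing.scale/= mulKf// gt_eqF.
  exact: is_deriveZ.
- rewrite -[X in _ --> X](mul0r (g + 1)^-1); apply: cvgMr_tmp.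
  apply: (cvg_comp _ _ (cvgn_at_right0 _ (cvgn_invS2 b)) (powR_cvg0 g10)).
  by move=> n; rewrite divr_gt0.
- exact: cvg_cst.
- by move=> x _; exact: powR_ge0.
Qed.

Lemma measurable_powR_EFin (g : R) (D : set R) :
  measurable_fun D (fun t : R => (t `^ g)%:E).
Proof.
apply/measurable_EFinP; apply: measurable_funTS; exact: measurable_powR.
Qed.

Lemma integrable_powR (g b : R) : -1 < g ->
  lam.-integrable `](0:R), b] (fun t => (t `^ g)%:E).
Proof.
move=> g1; have [b0|b0] := leP b 0.
  by rewrite set_itv_ge ?bnd_simp -?leNgt//; exact: integrable_set0.
apply/integrableP; split; first exact: measurable_powR_EFin.
under eq_integral do rewrite gee0_abs ?lee_fin ?powR_ge0//.
by rewrite integral_powR// ltry.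
Qed.

(** From s <= e^s with s = t / (2 g), raised to the power g. *)
Lemma powR_le_expR (g : R) : 0 <= g ->
  exists2 C, 0 <= C & forall t, 0 <= t -> t `^ g <= C * expR (t / 2).
Proof.
rewrite le_eqVlt => /predU1P[<-|g0].
  exists 1 => // t t0; rewrite powRr0 mul1r (le_trans _ (expR_ge1Dx _))//.
  by rewrite lerDl divr_ge0.
exists ((2 * g) `^ g); first exact: powR_ge0.
move=> t t0; have -> : expR (t / 2) = expR (t / (2 * g)) `^ g.
  by rewrite -expRM invfM -!mulrA [_^-1 * g]mulVf ?mulr1// gt_eqF.
rewrite -powRM ?expR_ge0//; last by rewrite mulr_ge0// ltW.
have g20 : 0 < 2 * g by rewrite mulr_gt0.
apply: ge0_ler_powR; rewrite ?nnegrE ?(ltW g0)//.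
  by rewrite mulr_ge0 ?expR_ge0// ltW.
rewrite mulrC -ler_pdivrMr//.
by rewrite (le_trans _ (expR_ge1Dx _))// lerDr.
Qed.

Lemma cvgn_expR_half : expR (- n.+1%:R / 2) @[n --> \oo] --> (0 : R).
Proof.
under eq_fun do rewrite mulNr.
have half0 : (0 : R) < 2^-1 by rewrite invr_gt0.
have h : (t / 2 : R) @[t --> +oo] --> +oo.
  by apply: (gt0_cvgMly half0); exact: cvg_id.
have H := cvg_comp _ _ h (@cvgr_expR R).
exact: (cvg_comp _ _ (@cvgn_natSy R) H).
Qed.

Lemma integrable_expR_half :
  lam.-integrable `](0 : R), +oo[ (fun t => (expR (- t / 2))%:E).
Proof.
have me : measurable_fun `](0:R), +oo[ (fun t : R => (expR (- t / 2))%:E).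
  apply/measurable_EFinP; apply: measurable_funTS.
  apply: measurableT_comp => //; apply: measurable_funM => //.
apply/integrableP; split => //.
under eq_integral do rewrite gee0_abs ?lee_fin ?expR_ge0//.
have dN (x : R) : is_derive x 1 (fun t : R => - t / 2) (- 2^-1).
  have -> : (fun t : R => - t / 2) = (- 2^-1) \*: id.
    by apply/funext => t /=; rewrite mulNr -mulrN mulrC.
  rewrite -[X in is_derive _ _ _ X](mulr1 (- 2^-1)).
  exact: is_deriveZ.
have dexp (x : R) :
    is_derive x 1 (fun t => expR (- t / 2)) (- 2^-1 * expR (- x / 2)).
  rewrite mulrC; apply: (is_derive1_comp _ (dN x)).
have cexp (x : R) : {for x, continuous (fun t : R => expR (- t / 2))}.
  by apply/differentiable_continuous/derivable1_diffP; have [] := dexp x.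
rewrite [ltLHS](_ : _ = (0 - -2)%:E) ?ltry//.
apply: (@ge0_FTC2_improper _ _ (fun t => - 2 * expR (- t / 2)) _
   (fun n => n.+2%:R^-1) (fun n => n.+1%:R)) => //.
- by move=> n; rewrite (@lt_le_trans _ _ 1) ?invf_lt1 ?ltr1n ?ler1n.
- apply/nondecreasing_seqP => n; rewrite subsetEset => x /=.
  rewrite !in_itv/= => /andP[nx xn]; apply/andP; split.
    by rewrite (le_trans _ nx)// lef_pV2 ?posrE// ler_nat.
  by rewrite (le_trans xn)// ler_nat.
- exact: itv0y_bigcup.
- move=> x _.
  rewrite [X in is_derive _ _ _ X](_ : _ =
    (-2) *: (- 2^-1 * expR (- x / 2))); last first.
    by rewrite /GRing.scale/= mulrA mulrNN mulfV ?mul1r.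
  have -> : (fun t => - 2 * expR (- t / 2)) =
    (-2) \*: (fun t => expR (- t / 2)) by [].
  exact: is_deriveZ.
- rewrite -[X in _ --> X]mulr1; apply: cvgMl_tmp.
  rewrite -[X in _ --> X](expR0).
  apply: (continuous_cvg _ (@continuous_expR R 0)).
  rewrite -[X in _ --> X](mul0r 2^-1); apply: cvgMr_tmp.
  rewrite -[X in _ --> X]oppr0; apply: cvgN.
  have := cvgn_invS2 (1 : R); under eq_fun do rewrite mul1r; exact.
- by rewrite -[X in _ --> X](mulr0 (-2)); apply: cvgMl_tmp; exact: cvgn_expR_half.
Qed.

Definition gamma_weight (g t : R) := t `^ g * expR (- t).

Lemma gamma_weight_ge0 g t : 0 <= gamma_weight g t.
Proof. by rewrite mulr_ge0 ?powR_ge0 ?expR_ge0. Qed.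

Lemma measurable_gamma_weight g : measurable_fun setT (gamma_weight g).
Proof.
apply: measurable_funM; first exact: measurable_powR.
by apply: measurableT_comp => //; exact: measurable_funN.
Qed.

(** Dominated by t^g on ]0, 1] and by a multiple of e^(-t/2) beyond. *)
Lemma integrable_gamma_weight (g : R) : -1 < g ->
  lam.-integrable `](0 : R), +oo[ (EFin \o gamma_weight g).
Proof.
move=> g1.
have [C C0 HC] : exists2 C, 0 <= C & forall t, 0 <= t ->
    t `^ (`|g|) <= C * expR (t / 2) by exact: powR_le_expR.
have int1 : lam.-integrable `](0 : R), +oo[
    ((fun t => (t `^ g)%:E) \_ `](0 : R), 1]).
  apply/integrable_restrict => //.
  rewrite setIidr; last by move=> x /=; rewrite !in_itv/= => /andP[->].
  exact: (integrable_powR _ g1).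
have int2 : lam.-integrable `](0 : R), +oo[
    (fun t => C%:E * (expR (- t / 2))%:E)%E.
  by apply: integrableZl => //; exact: integrable_expR_half.
apply: (le_integrable _ _ _ (integrableD _ int1 int2)) => //.
  apply/measurable_EFinP; apply: measurable_funTS; exact: measurable_gamma_weight.
move=> t /=; rewrite in_itv/= andbT => t0.
have E0 : 0 <= C * expR (- t / 2) by rewrite mulr_ge0 ?expR_ge0.
rewrite patchE; case: ifPn => [_|].
  rewrite -EFinM -EFinD /= (ger0_norm (gamma_weight_ge0 _ _)).
  rewrite ger0_norm ?addr_ge0 ?powR_ge0//.
  rewrite lee_fin -[leLHS]addr0 lerD// ler_piMr ?powR_ge0//.
  by rewrite expR_le1 oppr_le0 ltW.
rewrite notin_setE/= in_itv/= t0/= => /negP; rewrite -ltNge => t1.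
change (`|gamma_weight g t|%:E <=
        `|0 + C%:E * (expR (- t / 2))%:E|)%E.
rewrite add0e -EFinM /= lee_fin.
rewrite (ger0_norm (gamma_weight_ge0 _ _)) ger0_norm//.
have -> : expR (- t / 2) = expR (t / 2) * expR (- t).
  by rewrite -expRD; congr expR; lra.
rewrite mulrA ler_wpM2r ?expR_ge0// (le_trans _ (HC _ (ltW t0)))//.
by apply: ler_powR; [exact: ltW|exact: ler_norm].
Qed.

(** Minus the derivative of [gamma_weight g]. *)
Definition dgamma (g t : R) := gamma_weight g t - g * gamma_weight (g - 1) t.

Lemma integrable_dgamma (g : R) : 0 <= g ->
  lam.-integrable `](0 : R), +oo[ (EFin \o dgamma g).
Proof.
rewrite le_eqVlt => /predU1P[<-|g0].
  rewrite (_ : _ \o _ = EFin \o gamma_weight 0).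
    by apply: integrable_gamma_weight; rewrite ltrN10.
  by apply/funext => t; rewrite /dgamma /= mul0r subr0.
rewrite (_ : _ \o _ =
    (EFin \o gamma_weight g) \- (fun t => g%:E * (gamma_weight (g - 1) t)%:E))%E//.
apply: integrableB => //.
  by apply: integrable_gamma_weight; rewrite (lt_trans _ g0)// ltrN10.
apply: integrableZl => //; apply: integrable_gamma_weight.
by rewrite ltrBrDr addNr.
Qed.

Lemma continuous_gamma_weight (g x : R) : 0 < x ->
  {for x, continuous (gamma_weight g)}.
Proof.
move=> x0; apply: cvgM; first exact: continuous_powR_pos.
apply: (continuous_cvg _ (@continuous_expR R (- x))).
by apply: cvgN; exact: cvg_id.
Qed.

Lemma is_derive_gamma_weight (g x : R) : 0 < x ->
  is_derive x 1 (fun t : R => - gamma_weight g t) (dgamma g x).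
Proof.
move=> x0.
have d1 := @is_derive1_powR _ g x x0.
have dN : is_derive x 1 (fun t : R => - t) (- 1) by exact: is_deriveN.
have d2 : is_derive x 1 (fun t : R => expR (- t)) (expR (- x) * - 1).
  exact: (is_derive1_comp _ dN).
have d3 := is_deriveN (is_deriveM d1 d2).
apply: is_derive_eq; rewrite /dgamma /gamma_weight /GRing.scale /=.
by ring.
Qed.

Let cvgn_gamma_weight0 (g : R) (a : nat -> R) : 0 <= g -> (forall n, 0 < a n) ->
  a n @[n --> \oo] --> 0 ->
  - gamma_weight g (a n) @[n --> \oo] --> - ((g == 0)%:R : R).
Proof.
move=> g0 a0 cva; apply: cvgN; rewrite -[X in _ --> X]mulr1; apply: cvgM.
  have [->|gn0] := eqVneq g 0.
    by under eq_fun do rewrite powRr0; exact: cvg_cst.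
  have gp : 0 < g by rewrite lt_neqAle eq_sym gn0.
  exact: (cvg_comp _ _ (cvgn_at_right0 a0 cva) (powR_cvg0 gp)).
rewrite -[X in _ --> X]expR0; apply: (continuous_cvg _ (@continuous_expR R 0)).
by rewrite -[X in _ --> X]oppr0; exact: cvgN.
Qed.

(** The boundary term at 0 is the limit of t^g e^-t, which is 1 for g = 0 and 0
    for g > 0. *)
Lemma integral_dgamma (g b : R) : 0 <= g -> 0 < b ->
  (\int[lam]_(t in `]0%R, b]) (dgamma g t)%:E =
   ((g == 0)%:R - gamma_weight g b)%:E)%E.
Proof.
move=> g0 b0; rewrite addrC -[X in (_ + X)%:E]opprK.
apply: (@integrable_FTC2_improper _ _ (fun t => - gamma_weight g t) _
   (fun n => b / n.+2%:R) (fun=> b)).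
- by move=> n; rewrite divr_gt0.
- by move=> n; rewrite ltr_pdivrMr ?ltr0n// ltr_pMr// ltr1n.
- apply/nondecreasing_seqP => n; rewrite subsetEset => x /=.
  rewrite !in_itv/= => /andP[nx ->]; rewrite andbT (le_trans _ nx)//.
  by rewrite ler_pM2l// lef_pV2 ?posrE ?ltr0n// ler_nat.
- exact: itv0b_bigcup.
- move=> x x0; apply: cvgB; first exact: continuous_gamma_weight.
  by apply: cvgMl_tmp; exact: continuous_gamma_weight.
- by move=> x; exact: is_derive_gamma_weight.
- apply: cvgn_gamma_weight0 => //; last exact: cvgn_invS2.
  by move=> n; rewrite divr_gt0.
- exact: cvg_cst.
- apply: integrableS (integrable_dgamma g0) => //.
  by move=> x /=; rewrite !in_itv/= => /andP[->].
Qed.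

Lemma integral_dgammay (g : R) : 0 <= g ->
  (\int[lam]_(t in `]0%R, +oo[) (dgamma g t)%:E = ((g == 0)%:R)%:E)%E.
Proof.
move=> g0; rewrite -[X in _ = X%:E]add0r -[X in (_ + X)%:E]opprK.
apply: (@integrable_FTC2_improper _ _ (fun t => - gamma_weight g t) _
   (fun n => n.+2%:R^-1) (fun n => n.+1%:R)).
- by move=> n; rewrite invr_gt0.
- by move=> n; rewrite (@lt_le_trans _ _ 1) ?invf_lt1 ?ltr1n ?ler1n.
- apply/nondecreasing_seqP => n; rewrite subsetEset => x /=.
  rewrite !in_itv/= => /andP[nx xn]; apply/andP; split.
    by rewrite (le_trans _ nx)// lef_pV2 ?posrE// ler_nat.
  by rewrite (le_trans xn)// ler_nat.
- exact: itv0y_bigcup.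
- move=> x x0; apply: cvgB; first exact: continuous_gamma_weight.
  by apply: cvgMl_tmp; exact: continuous_gamma_weight.
- by move=> x; exact: is_derive_gamma_weight.
- apply: cvgn_gamma_weight0 => //.
  by have := cvgn_invS2 (1 : R); under eq_fun do rewrite mul1r; exact.
- rewrite -[X in _ --> X]oppr0; apply: cvgN.
  have [C C0 HC] := powR_le_expR g0.
  apply: (@squeeze_cvgr _ _ _ _ (fun=> 0) (fun n => C * expR (- n.+1%:R / 2))).
  + apply: nearW => n; rewrite gamma_weight_ge0/=.
    have -> : expR (- n.+1%:R / 2) = expR (n.+1%:R / 2) * expR (- n.+1%:R) :> R.
      by rewrite -expRD; congr expR; lra.
    by rewrite mulrA ler_wpM2r ?expR_ge0// HC.
  + exact: cvg_cst.
  + by rewrite -[X in _ --> X](mulr0 C); apply: cvgMl_tmp; exact: cvgn_expR_half.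
- exact: integrable_dgamma.
Qed.

End gamma.

(** * Integration over tuples *)

Section tuple_integral.
Context {R : realType}.
Local Notation lam := (@lebesgue_measure R).
Local Notation lamn := (lebesgue_tuple R).

Lemma ge0_integral_lebesgue_tupleS n (f : n.+1.-tuple R -> \bar R) :
  measurable_fun setT f -> (forall x, 0 <= f x)%E ->
  (\int[lamn n.+1]_x f x = \int[lamn n]_t \int[lam]_h f (consp (h, t)))%E.
Proof.
move=> mf f0.
transitivity (\int[pushforward (lam \x lamn n) (@consp R n)]_x f x)%E.
  by [].
rewrite (ge0_integral_pushforward (@measurable_consp R n))//.
rewrite preimage_setT (fubini_tonelli2 (f \o @consp R n))//.
by apply: measurableT_comp => //; exact: measurable_consp.
by move=> p; exact: f0.
Qed.

Lemma integral_lebesgue_tupleS n (f : n.+1.-tuple R -> \bar R) :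
  measurable_fun setT f ->
  (lam \x lamn n)%E.-integrable setT (f \o @consp R n) ->
  (lamn n.+1).-integrable setT f /\
  (\int[lamn n.+1]_x f x = \int[lam \x lamn n]_p f (consp p))%E.
Proof.
move=> mf intf; split.
  exact: (@integrable_pushforward _ _ _ _ _ _ (@measurable_consp R n)).
rewrite -[LHS]/(\int[pushforward (lam \x lamn n)%E (@consp R n)]_x f x)%E.
by rewrite (integral_pushforward (@measurable_consp R n) mf).
Qed.

Lemma integrable_prodM d1 d2 (T1 : measurableType d1) (T2 : measurableType d2)
    (m1 : {sigma_finite_measure set T1 -> \bar R})
    (m2 : {sigma_finite_measure set T2 -> \bar R}) (f : T1 -> R) (g : T2 -> R) :
  m1.-integrable setT (EFin \o f) -> m2.-integrable setT (EFin \o g) ->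
  (m1 \x m2)%E.-integrable setT (fun p => (f p.1 * g p.2)%:E) /\
  (\int[m1 \x m2]_p (f p.1 * g p.2)%:E =
   (\int[m1]_x f x)%:E * (\int[m2]_x g x)%:E)%E.
Proof.
move=> intf intg.
have mf : measurable_fun setT f by apply/measurable_EFinP; exact: measurable_int intf.
have mg : measurable_fun setT g by apply/measurable_EFinP; exact: measurable_int intg.
have mfg : measurable_fun setT (fun p : T1 * T2 => (f p.1 * g p.2)%:E).
  apply/measurable_EFinP/measurable_funM.
    by apply: measurableT_comp => //; exact: measurable_fst.
  by apply: measurableT_comp => //; exact: measurable_snd.
have intfg : (m1 \x m2)%E.-integrable setT (fun p => (f p.1 * g p.2)%:E).
  apply/integrable12ltyP => //.
  have /integrableP[_ flt] := intf; have /integrableP[_ glt] := intg.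
  rewrite [ltLHS](_ : _ =
      (\int[m2]_y `|(g y)%:E| * \int[m1]_x `|(f x)%:E|))%E; last first.
    rewrite -ge0_integralZl//; last 2 first.
      by apply: measurableT_comp => //; exact/measurable_EFinP.
      exact: integral_ge0.
    apply: eq_integral => x _; rewrite muleC -ge0_integralZl//; last first.
      by apply: measurableT_comp => //; exact/measurable_EFinP.
    by apply: eq_integral => y _; rewrite EFinM abseM.
  by rewrite lte_mul_pinfty// ?integral_ge0// ge0_fin_numE// integral_ge0.
split => //; rewrite -integral12_prod_meas1//.
have gE : ((\int[m2]_x g x)%:E = \int[m2]_x (g x)%:E)%E.
  by rewrite fineK//; exact: integrable_fin_num.
rewrite [X in (X * _)%E]fineK; last exact: integrable_fin_num.
rewrite -integralZr//; apply: eq_integral => x _.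
rewrite gE /fubini_F /= -integralZl//.
Qed.


Lemma integral_tuple_prod n (g : 'I_n -> R -> R) :
  (forall i, lam.-integrable setT (EFin \o g i)) ->
  (lamn n).-integrable setT (fun x => (\prod_i g i (tnth x i))%:E) /\
  (\int[lamn n]_x (\prod_i g i (tnth x i))%:E =
   (\prod_i \int[lam]_t g i t)%:E)%E.
Proof.
elim: n g => [|n IH] g intg.
  have mf : measurable_fun setT
      (fun x : 0.-tuple R => (\prod_(i < 0) g i (tnth x i))%:E).
    by apply/measurable_EFinP; apply: measurable_prod => -[].
  split; last first.
    rewrite [LHS](_ : _ = \int[\d_ [tuple]]_x
      (\prod_(i < 0) g i (tnth x i))%:E)%E//.
    by rewrite integral_dirac// diracT mul1e !big_ord0.
  apply/integrableP; split => //.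
  rewrite [ltLHS](_ : _ = \int[\d_ [tuple]]_x
      `|(\prod_(i < 0) g i (tnth x i))%:E|)%E//.
  rewrite integral_dirac//; last exact: measurableT_comp.
  by rewrite diracT mul1e ltry.
have [int_t Et] := IH (fun i => g (lift ord0 i)) (fun i => intg _).
have [] := integrable_prodM (intg ord0) int_t.
have E (p : measurableTypeR R * n.-tuple R) :
  (\prod_i g i (tnth (consp p) i))%:E =
  (g ord0 p.1 * \prod_i g (lift ord0 i) (tnth p.2 i))%:E.
  rewrite big_ord_recl; congr (_ * _)%:E; apply: eq_bigr => i _.
  by rewrite tnthS.
have mf : measurable_fun setT
      (fun x : n.+1.-tuple R => (\prod_i g i (tnth x i))%:E).
  apply/measurable_EFinP; apply: measurable_prod => i _.
  apply: measurableT_comp; last exact: measurable_tnth.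
  by apply/measurable_EFinP; exact: measurable_int (intg i).
move=> int1 int2.
have [] := integral_lebesgue_tupleS mf.
  by apply: eq_integrable int1 => // p _; rewrite /= E.
move=> H1 H2; split => //; rewrite H2.
under eq_integral do rewrite E.
rewrite int2 big_ord_recl EFinM; congr (_ * _)%E.
by rewrite [X in (X%:E)%E]/Rintegral Et.
Qed.

(** Leibniz expansion, then Fubini for each product: row i depends on the
    coordinate i only. *)
Lemma integral_tuple_det n (g : 'I_n -> 'I_n -> R -> R) :
  (forall i j, lam.-integrable setT (EFin \o g i j)) ->
  (lamn n).-integrable setT
    (fun x => (\det (\matrix_(i, j) g i j (tnth x i)))%:E) /\
  (\int[lamn n]_x (\det (\matrix_(i, j) g i j (tnth x i)))%:E =
   (\det (\matrix_(i, j) \int[lam]_t g i j t))%:E)%E.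
Proof.
move=> intg.
have E x : (\det (\matrix_(i, j) g i j (tnth x i)))%:E =
    (\sum_(s : {perm 'I_n})
      ((-1) ^+ s : R)%:E * (\prod_i g i (s i) (tnth x i))%:E)%E.
  rewrite /determinant -sumEFin; apply: eq_bigr => s _; rewrite EFinM.
  by congr (_ * _%:E)%E; apply: eq_bigr => i _; rewrite mxE.
have ints (s : {perm 'I_n}) := integral_tuple_prod (fun i => intg i (s i)).
have intZ (s : {perm 'I_n}) : (lamn n).-integrable setT
    (fun x => ((-1) ^+ s : R)%:E * (\prod_i g i (s i) (tnth x i))%:E)%E.
  by apply: integrableZl => //; exact: (ints s).1.
split.
  have H := integrable_sum measurableT (index_enum _) (P := xpredT)
    (fun s _ => intZ s).
  by apply: eq_integrable H => // x _; rewrite E.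
under eq_integral do rewrite E.
rewrite integral_sum// /determinant -sumEFin; apply: eq_bigr => s _.
rewrite integralZl//; last exact: (ints s).1.
rewrite (ints s).2 EFinM; congr (_ * _%:E)%E.
by apply: eq_bigr => i _; rewrite mxE.
Qed.

(** The function is not assumed to be measurable: its integral is a supremum over
    nonnegative simple functions below it, and these may be cut off on the null
    set. This matters for the kernel on the boundary of the chamber, about
    which only nonnegativity is used. *)
Lemma ge0_integral_setD_null d (T : measurableType d) (mu : {measure set T -> \bar R})
    (D N : set T) (f : T -> \bar R) :
  measurable D -> measurable N -> mu N = 0%E ->
  (forall x, D x -> 0 <= f x)%E ->
  (\int[mu]_(x in D) f x = \int[mu]_(x in D `\` N) f x)%E.
Proof.
Import HBNNSimple.
move=> mD mN N0 f0.
rewrite !(integral_mkcond _ f).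
have p0 E : E `<=` D -> forall x, (0 <= (f \_ E) x)%E.
  by move=> ED x; rewrite patchE; case: ifPn => // /set_mem/ED; exact: f0.
rewrite !ge0_integralTE//; last 2 first.
- by apply: p0 => x [].
- exact: p0.
apply/eqP; rewrite eq_le; apply/andP; split; apply: ge_ereal_sup => _ [h hf <-].
- apply: ereal_sup_ubound => /=.
  (* a simple function below f on D, cut off on N *)
  exists (proj_nnsfun h (measurableC mN)).
    move=> x; rewrite /= /mindic indicE; have := hf x; rewrite !patchE in_setC in_setD.
    case: (x \in N) => /=; rewrite ?mulr0 ?mulr1 ?andbF ?andbT//.
  have neg (k : {nnsfun T >-> R}) : (\int[mu]_(x in setT) (k x)%:E =
      \int[mu]_(x in setT `\` N) (k x)%:E)%E.
    apply: ge0_negligible_integral => //; first exact/measurable_EFinP.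
    by move=> x _; rewrite lee_fin.
  rewrite -!integralT_nnsfun [LHS]neg [RHS]neg.
  apply: eq_integral => x; rewrite in_setD => /andP[_ xN] /=.
  by rewrite /mindic indicE in_setC xN mulr1.
- apply: ereal_sup_ubound => /=; exists h => // x.
  rewrite (le_trans (hf x))// !patchE in_setD; case: ifPn => [/andP[->]//|_].
  by case: ifPn => // /set_mem; exact: f0.
Qed.

Lemma measurable_nth n i : measurable_fun setT (fun x : n.-tuple R => x`_i).
Proof.
have [ni|ni] := leqP n i.
  rewrite (_ : (fun _ => _) = cst 0); first exact: measurable_cst.
  by apply/funext => x; rewrite nth_default ?size_tuple.
rewrite (_ : (fun _ => _) = (@tnth _ _ ^~ (Ordinal ni))).
  exact: measurable_tnth.
by apply/funext => x; rewrite (tnth_nth 0).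
Qed.


(** This set contains the part of the chamber that is not in the open chamber. It
    is null by Fubini: once the last coordinates are distinct and nonzero, the
    first one is confined to a finite set. *)
Lemma lebesgue_tuple_not_uniq n :
  measurable [set x : n.-tuple R | ~~ uniq (0 :: x)] /\
  lamn n [set x : n.-tuple R | ~~ uniq (0 :: x)] = 0%E.
Proof.
have mB k : measurable [set x : k.-tuple R | ~~ uniq (0 :: x)].
  rewrite (_ : [set _ | _] = \bigcup_i \bigcup_j
    if (i < j < k.+1)%N then [set x : k.-tuple R | (0 :: x)`_i = (0 :: x)`_j]
    else set0); last first.
    apply/seteqP; split => x.
      move=> /(uniqPn (0 : R))[i [j [ij js e]]]; exists i => //; exists j => //.
      by rewrite ij -[k in (_ < k.+1)%N](size_tuple x) js.
    move=> [i _ [j _]]; case: ifPn => // /andP[ij jk] e; apply/(uniqPn (0 : R)).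
    by exists i, j; rewrite /= size_tuple.
  apply: bigcup_measurable => i _; apply: bigcup_measurable => j _.
  case: ifP => // _.
  have mnth l : measurable_fun setT (fun x : k.-tuple R => (0 :: x)`_l).
    by case: l => [|l] //=; exact: measurable_nth.
  rewrite (_ : mkset _ = (fun x : k.-tuple R => (0 :: x)`_i == (0 :: x)`_j)
      @^-1` [set true]); last by apply/seteqP; split => x /= /eqP.
  by rewrite -[X in measurable X]setTI; apply: measurable_fun_eqr.
split => //; elim: n => [|n IH].
  rewrite (_ : [set _ : 0.-tuple R | _] = set0) ?measure0//.
  by rewrite -subset0 => x /=; rewrite (tuple0 x).
transitivity (\int[lamn n.+1]_x
    (\1_[set x : n.+1.-tuple R | ~~ uniq (0 :: x)] x)%:E)%E.
  rewrite integral_indic//; first by rewrite setIT.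
  exact: mB.
rewrite ge0_integral_lebesgue_tupleS//; last first.
  by apply/measurable_EFinP; apply: measurable_indic; exact: mB.
rewrite (ge0_integral_setD_null _ (mB n) IH)//; last first.
  by move=> t _; apply: integral_ge0 => h _.
apply: integral0_eq => t [_] /= /negP/negPn ut.
transitivity (\int[lam]_(h in setT) (\1_[set` 0 :: tval t] h)%:E)%E.
  apply: eq_integral => h _; rewrite !indicE.
  have E : ~~ uniq [:: 0, h & t] = (h \in 0 :: tval t).
    move: ut => /= /andP[ut1 ut2].
    by rewrite !inE negb_or (eq_sym 0 h) ut1 ut2 !andbT negb_and !negbK.
  congr ((nat_of_bool _)%:R%:E); apply/idP/idP => /set_mem H; apply/mem_set.
    by rewrite /= -E.
  by rewrite /= E.
have cB : countable [set` 0 :: tval t].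
  by apply: finite_set_countable; apply/finite_seqP; exists (0 :: tval t).
rewrite integral_indic//; last first.
  by apply: countable_measurable => // r; exact: measurable_set1.
by rewrite setIT; exact: countable_lebesgue_measure0.
Qed.

Lemma chamber_uniq n (x : n.-tuple R) :
  open_chamber n x <-> chamber n x /\ uniq (0 :: x).
Proof.
rewrite /open_chamber /chamber /=.
rewrite -[path <%R 0 x]/(sorted <%R (0 :: x)) lt_sorted_uniq_le.
by split=> [/andP[us ls]|[ls us]]; [split|apply/andP].
Qed.

End tuple_integral.

(** * Integrals over interlacing boxes *)

Section box.
Context {R : realType}.
Local Notation lam := (@lebesgue_measure R).
Local Notation lamn := (lebesgue_tuple R).

(** The upper bound is dropped where s is exhausted and the lengths are not
    constrained, so that the same relation covers z given x, z given y, and, through [interlacedC], x and y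
    given z. *)
Definition interlaced (s : seq R) n (t : n.-tuple R) : bool :=
  [forall i : 'I_n, (s`_i <= tnth t i) &&
    ((i.+1 < size s)%N ==> (tnth t i <= s`_i.+1))].

Lemma interlacedP (s : seq R) n (t : n.-tuple R) :
  reflect (forall i, (i < n)%N ->
    s`_i <= t`_i /\ ((i.+1 < size s)%N -> t`_i <= s`_i.+1)) (interlaced s t).
Proof.
apply: (iffP forallP) => [h i ni|h i].
  have /andP[] := h (Ordinal ni); rewrite (tnth_nth 0) /= => -> /implyP st.
  by split.
have [h1 h2] := h i (ltn_ord i); rewrite (tnth_nth 0) h1 /=.
exact/implyP.
Qed.

(** The inequalities x_0 <= z_0 <= x_1 <= z_1 <= ... also say that x interlaces
    with 0, z_0, z_1, ..., apart from the condition 0 <= x_0. *)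
Lemma interlacedC n N (x : n.-tuple R) (z : N.-tuple R) :
  (N <= n <= N.+1)%N -> 0 <= x`_0 -> interlaced x z = interlaced (0 :: z) x.
Proof.
move=> /andP[Nn nN] x0; apply/interlacedP/interlacedP => h i ni.
  split; last by rewrite /= ltnS size_tuple => iN; have [] := h i iN.
  case: i ni => [//|i] ni /=.
  by have [_] := h i (leq_trans ni nN); rewrite size_tuple; apply.
have [h1 h2] := h i (leq_trans ni Nn); split.
  by apply: h2; rewrite /= size_tuple.
by rewrite size_tuple => /h[].
Qed.

Definition right_end (s : seq R) (k : nat) : itv_bound R :=
  if (k < size s)%N then BRight s`_k else +oo%O.

Definition interval_of (s : seq R) (k : nat) : set R :=
  [set` Interval (BLeft s`_k) (right_end s k.+1)].

Lemma interlaced_interval (s : seq R) n (t : n.-tuple R) :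
  interlaced s t <-> forall i : 'I_n, interval_of s i (tnth t i).
Proof.
rewrite /interlaced /interval_of /right_end.
split => [/forallP h i|h]; [have := h i|apply/forallP => i; have := h i];
  rewrite /= in_itv/=; by case: ifP.
Qed.

(** The interval is open at 0, where the integrands may be singular, and b may be
    +oo. *)
Definition primitive (f : R -> R) (b : itv_bound R) : R :=
  \int[lam]_(t in [set` Interval (BRight 0) b]) f t.

Lemma Rintegral_primitive (f : R -> R) (a : R) (b : itv_bound R) :
  0 <= a -> (BRight a <= b)%O ->
  lam.-integrable [set` Interval (BRight 0) b] (EFin \o f) ->
  \int[lam]_(t in [set` Interval (BLeft a) b]) f t =
  primitive f b - primitive f (BRight a).
Proof.
move=> a0 ab intf; rewrite /primitive Rintegral_itvB//.
rewrite Rintegral_itv_obnd_cbnd//.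
apply: integrableS intf => //; apply: subset_itvr.
by rewrite bnd_simp.
Qed.

Lemma eq_primitive (f g : R -> R) b : (forall t, 0 < t -> f t = g t) ->
  primitive f b = primitive g b.
Proof.
move=> fg; apply: eq_Rintegral => t; rewrite inE/=.
by rewrite itv_boundlr => /andP[+ _]; rewrite bnd_simp => /fg.
Qed.

Lemma primitive0 f : primitive f (BRight 0) = 0.
Proof. by rewrite /primitive set_itv_ge ?bnd_simp ?ltxx// Rintegral_set0. Qed.

Lemma integrable_itv_closed_left (f : R -> R) (b c : itv_bound R) (a : R) :
  lam.-integrable [set` Interval (BRight 0) b] (EFin \o f) ->
  measurable_fun setT f -> 0 <= a -> (c <= b)%O ->
  lam.-integrable [set` Interval (BLeft a) c] (EFin \o f).
Proof.
move=> intf mf a0 cb.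
suff : lam.-integrable [set` Interval (BLeft 0) c] (EFin \o f).
  apply: integrableS => //; apply: subset_itvr.
  by rewrite bnd_simp.
have intc : lam.-integrable [set` Interval (BRight 0) c] (EFin \o f).
  by apply: integrableS intf => //; exact: subset_itvl.
have mEf D : measurable_fun D (EFin \o f).
  by apply/measurable_EFinP; exact: measurable_funTS.
apply/integrableP; split; first exact: mEf.
rewrite -integral_itv_obnd_cbnd; first by have /integrableP[] := intc.
by apply: measurableT_comp => //; exact: mEf.
Qed.

(** The indicator of the box is a product over the coordinates, hence scales the
    rows of the matrix. *)
Lemma integral_box n (s : seq R) (f : 'I_n -> R -> R) :
  (forall i j : 'I_n, lam.-integrable (interval_of s i) (EFin \o f j)) ->
  (\int[lamn n]_(t in [set t | interlaced s t])
     (\det (\matrix_(i, j) f j (tnth t i)))%:E =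
   (\det (\matrix_(i, j) \int[lam]_(t in interval_of s i) f j t))%:E)%E.
Proof.
move=> intf.
have mI (i : 'I_n) : measurable (interval_of s i) by exact: measurable_itv.
pose g (i j : 'I_n) := f j \_ (interval_of s i).
have intg i j : lam.-integrable setT (EFin \o g i j).
  rewrite -restrict_EFin. 
  by apply: (iffLR (integrable_mkcond _ _)); [exact: measurable_itv|exact: intf].
rewrite integral_mkcond.
transitivity (\int[lamn n]_t (\det (\matrix_(i, j) g i j (tnth t i)))%:E)%E.
  apply: eq_integral => t _; rewrite patchE.
  have E : \det (\matrix_(i, j) g i j (tnth t i)) =
    \prod_(i < n) \1_(interval_of s i) (tnth t i) *
    \det (\matrix_(i, j) f j (tnth t i)).
    have := det_scale (fun i : 'I_n => \1_(interval_of s i) (tnth t i)) (fun=> 1)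
      (fun i j : 'I_n => f j (tnth t i)).
    rewrite [X in _ * X]big1// mulr1 => <-; congr (\det _).
    apply/matrixP => i j; rewrite !mxE mulr1 /g patchE indicE.
    by case: ifP; rewrite (mul0r, mul1r).
  rewrite E; case: ifPn => [/set_mem /=|].
    move=> /interlaced_interval it; rewrite big1 ?mul1r// => i _.
    by rewrite indicE mem_set.
  rewrite notin_setE /= => /interlaced_interval /existsNP[i it].
  by rewrite (bigD1 i)//= indicE memNset// !mul0r.
rewrite (integral_tuple_det intg).2; congr (\det _)%:E.
by apply/matrixP => i j; rewrite !mxE [RHS]Rintegral_mkcond.
Qed.

Lemma right_end_homo (s : seq R) i j : sorted <=%R s -> (i <= j)%N ->
  (right_end s i <= right_end s j)%O.
Proof.
move=> ss ij; rewrite /right_end; case: ifPn => [is_|]; last first.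
  by rewrite -!leqNgt => si; rewrite ltnNge (leq_trans si ij).
case: ifPn => [js|_]; last by [].
rewrite bnd_simp; have := sorted_leq_nth (@le_trans _ R) (@le_refl _ R) 0 ss.
by apply.
Qed.

Lemma integral_box_primitive n (s : seq R) (f : 'I_n -> R -> R) :
  path <=%R 0 s -> (n <= size s)%N ->
  (forall j, measurable_fun setT (f j)) ->
  (forall j, lam.-integrable [set` Interval (BRight 0) (right_end s n)]
    (EFin \o f j)) ->
  (\int[lamn n]_(t in [set t | interlaced s t])
     (\det (\matrix_(i, j) f j (tnth t i)))%:E =
   (\det (\matrix_(i < n, j < n)
     (primitive (f j) (right_end s i.+1) - primitive (f j) (right_end s i))))%:E)%E.
Proof.
move=> ps ns mf intf; have ss := path_sorted ps.
have s0 i : (i < size s)%N -> 0 <= s`_i.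
  have /allP h := order_path_min (@le_trans _ R) ps.
  by move=> ?; exact/h/mem_nth.
rewrite integral_box; last first.
  move=> i j; apply: integrable_itv_closed_left (intf j) _ _ _ => //.
    by apply: s0; exact: leq_trans ns.
  exact: right_end_homo.
congr (\det _)%:E; apply/matrixP => i j; rewrite !mxE.
have is_ : (i < size s)%N by exact: leq_trans ns.
have uE : right_end s i = BRight s`_i by rewrite /right_end is_.
rewrite Rintegral_primitive ?uE// ?s0//.
  by rewrite -uE right_end_homo.
apply: integrableS (intf j) => //; apply: subset_itvl.
exact: right_end_homo.
Qed.

End box.

(** * The four interlacing integrals of Vandermonde determinants *)

Section box_values.
Context {R : realType}.
Local Notation lam := (@lebesgue_measure R).
Local Notation lamn := (lebesgue_tuple R).

Lemma primitive_dgamma (g b : R) : 0 <= g -> 0 <= b ->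
  primitive (dgamma g) (BRight b) = (g == 0)%:R - gamma_weight g b.
Proof.
move=> g0; rewrite le_eqVlt => /predU1P[<-|b0]; last first.
  by rewrite /primitive /Rintegral integral_dgamma.
rewrite primitive0 /gamma_weight oppr0 expR0 mulr1.
have [->|gn0] := eqVneq g 0; first by rewrite powRr0 subrr.
by rewrite powR0// subr0.
Qed.

Lemma primitive_dgammay (g : R) : 0 <= g -> primitive (dgamma g) +oo%O = (g == 0)%:R.
Proof. by move=> g0; rewrite /primitive /Rintegral integral_dgammay. Qed.

Lemma primitive_powR (g b : R) : -1 < g -> 0 <= b ->
  primitive (fun t => t `^ g) (BRight b) = b `^ (g + 1) / (g + 1).
Proof.
move=> g1; rewrite le_eqVlt => /predU1P[<-|b0]; last first.
  by rewrite /primitive /Rintegral integral_powR.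
by rewrite primitive0 powR0 ?mul0r// gt_eqF// -ltrBlDr sub0r.
Qed.

Lemma det_vandermonde_weight n (c : nat -> R) (w : R -> R) (t : n.-tuple R) :
  c 0 = 0 ->
  \det (\matrix_(i < n, j < n)
    ((tnth t i ^+ j - c j * tnth t i ^+ j.-1) * w (tnth t i))) =
  vandermonde t * \prod_i w (tnth t i).
Proof.
move=> c0; rewrite /vandermonde -(det_bidiag_vandermonde _ c0).
have := det_scale (fun i => w (tnth t i)) (fun=> 1)
  (fun i j : 'I_n => tnth t i ^+ j - c j * tnth t i ^+ j.-1).
rewrite [X in _ * X]big1// mulr1 [RHS]mulrC => <-; congr (\det _).
by apply/matrixP => i j; rewrite !mxE mulr1 mulrC.
Qed.

Lemma vandermonde_det n (w : R -> R) (t : n.-tuple R) :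
  \det (\matrix_(i < n, j < n) (tnth t i ^+ j * w (tnth t i))) =
  vandermonde t * \prod_i w (tnth t i).
Proof.
rewrite -(@det_vandermonde_weight _ (fun=> 0))//; congr (\det _).
by apply/matrixP => i j; rewrite !mxE mul0r subr0.
Qed.

(** The functions [h j] are the integrands [p_j * w], for the monic polynomials
    p_j = X^j - c_j X^(j-1), in a form whose primitive is known; they need only
    agree with them away from 0. *)
Lemma integral_box_vandermonde n (s : seq R) (c : nat -> R) (w : R -> R)
    (h : nat -> R -> R) :
  c 0 = 0 -> path <=%R 0 s -> (n <= size s)%N -> measurable_fun setT w ->
  (forall j t, (j < n)%N -> 0 < t ->
    (t ^+ j - c j * t ^+ j.-1) * w t = h j t) ->
  (forall j, (j < n)%N ->
    lam.-integrable [set` Interval (BRight 0) (right_end s n)] (EFin \o h j)) ->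
  (\int[lamn n]_(t in [set t | interlaced s t])
     (vandermonde t * \prod_i w (tnth t i))%:E =
   (\det (\matrix_(i < n, j < n)
     (primitive (h j) (right_end s i.+1) - primitive (h j) (right_end s i))))%:E)%E.
Proof.
move=> c0 ps ns mw fh inth.
under eq_integral do rewrite -(det_vandermonde_weight w _ c0).
rewrite (integral_box_primitive (f := fun (j : 'I_n) t =>
  (t ^+ j - c j * t ^+ j.-1) * w t))//.
- congr (\det _)%:E; apply/matrixP => i j; rewrite !mxE.
  by congr (_ - _); apply: eq_primitive => t t0; rewrite fh.
- move=> j; apply: measurable_funM => //; apply: measurable_funB.
    exact: measurable_funX.
  by apply: measurable_funM => //; exact: measurable_funX.
- move=> j; apply: eq_integrable (inth j (ltn_ord j)) => //.
  move=> t; rewrite inE/= itv_boundlr => /andP[+ _].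
  by rewrite bnd_simp => t0; rewrite -fh.
Qed.

Lemma powRDn (a x : R) n : 0 < a -> 0 <= x ->
  x `^ (a + n%:R) = x `^ a * x ^+ n.
Proof.
move=> a0 x0; rewrite powRD ?powR_mulrn//.
by rewrite gt_eqF// ltr_wpDr.
Qed.

(** The choice c_j = a + j makes p_j times the gamma weight an exact derivative. *)
Lemma dgamma_powR (a t : R) j : 0 < t ->
  (t ^+ j.+1 - (a + j.+1%:R) * t ^+ j) * gamma_weight a t =
  dgamma (a + j.+1%:R) t.
Proof.
move=> t0; rewrite /dgamma /gamma_weight.
have t0' : t != 0 by rewrite gt_eqF.
have -> : a + j.+1%:R - 1 = a + j%:R by rewrite -natr1 addrA addrK.
rewrite !powRD ?t0' ?implybT//.
by rewrite !powR_mulrn ?ltW//=; ring.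
Qed.

Lemma chamber_ge0 n (s : n.-tuple R) i : path <=%R 0 s -> 0 <= s`_i.
Proof.
move=> ps; have [ni|ni] := leqP n i; first by rewrite nth_default ?size_tuple.
have /allP h := order_path_min (@le_trans _ R) ps.
by apply: h; rewrite mem_nth ?size_tuple.
Qed.

(** All columns but the first are exact derivatives of functions that vanish at 0
    and at +oo, so that the last row, which collects the integrals over the whole
    half-line, is (G, 0, ..., 0). *)
Lemma integral_interlaced_gamma N (alpha : R) (z : N.-tuple R) : -1 < alpha ->
  path <=%R 0 z ->
  (\int[lamn N.+1]_(x in [set x | interlaced (0%R :: z) x])
     (vandermonde x * \prod_i gamma_weight alpha (tnth x i))%:E =
   (primitive (gamma_weight alpha) +oo%O *
     (vandermonde z * \prod_i gamma_weight (alpha + 1) (tnth z i)))%:E)%E.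
Proof.
move=> a1 pz.
pose c (j : nat) := if j is 0 then 0 else alpha + j%:R : R.
pose h (j : nat) := if j is 0 then gamma_weight alpha
  else dgamma (alpha + j%:R) : R -> R.
have aj j : 0 < alpha + j.+1%:R.
  by rewrite -natr1 addrCA (@lt_le_trans _ _ (alpha + 1)) ?lerDr// -ltrBlDr sub0r.
rewrite (@integral_box_vandermonde _ _ c (gamma_weight alpha) h)//=.
- congr (_%:E).
  rewrite (@det_row_diff0 _ _ (fun i (j : 'I_N.+1) =>
    primitive (h j) (right_end (0 :: z) i))); last first.
    by move=> j; rewrite /right_end/= primitive0.
  rewrite (@det_last_row _ _ (fun i j => primitive (h j) (right_end (0 :: z) i.+1))).
    rewrite /right_end/= size_tuple ltnn; congr (_ * _).
    rewrite [X in \det X](_ : _ = (-1) *: \matrix_(i < N, j < N)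
        (tnth z i ^+ j * gamma_weight (alpha + 1) (tnth z i))); last first.
      apply/matrixP => i j; rewrite !mxE /= ltnS ltn_ord.
      rewrite primitive_dgamma ?chamber_ge0 ?ltW// gt_eqF// sub0r mulN1r.
      rewrite -(tnth_nth 0); congr (- _); rewrite /gamma_weight mulrA.
      congr (_ * _).
      have -> : alpha + j.+1%:R = alpha + 1 + j%:R by rewrite -natr1 addrA addrAC.
      rewrite powRDn 1?mulrC//; first by rewrite -ltrBlDr sub0r.
      by rewrite (tnth_nth 0) chamber_ge0.
    by rewrite detZ vandermonde_det mulrA -exprMn mulrNN mulr1 expr1n mul1r.
  move=> j jN; rewrite /right_end/= size_tuple ltnn primitive_dgammay ?ltW//.
  by rewrite gt_eqF.
- by rewrite lexx.
- by rewrite size_tuple.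
- exact: measurable_gamma_weight.
- case=> [|j] t _ t0; first by rewrite /c/h mul0r subr0 mul1r.
  exact: dgamma_powR.
- move=> j _; rewrite /right_end/= size_tuple ltnn.
  case: j => [|j]; first exact: integrable_gamma_weight.
  by apply: integrable_dgamma; exact: ltW.
Qed.

(** Same choice of polynomials with exponent 0, where also the column 0 is an exact
    derivative; the tails D of the primitives vanish at +oo. *)
Lemma integral_interlaced_expR N (y : N.-tuple R) : path <=%R 0 y ->
  (\int[lamn N]_(z in [set z | interlaced y z])
     (vandermonde z * \prod_i expR (- tnth z i))%:E =
   (vandermonde y * \prod_i expR (- tnth y i))%:E)%E.
Proof.
move=> py.
rewrite (@integral_box_vandermonde _ _ (fun j => j%:R) (fun t => expR (- t))
  (fun j => dgamma j%:R))//=.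
- congr (_%:E).
  (* the integrals over the right tails, whose differences are opposite to those
     of the primitives *)
  pose D (i : nat) (j : 'I_N) := primitive (dgamma j%:R) +oo%O
                               - primitive (dgamma j%:R) (right_end y i) : R.
  rewrite [X in \det X](_ : _ = \matrix_(i < N, j < N) (D i j - D i.+1 j)).
    rewrite det_row_diffn; last first.
      by move=> j; rewrite /D /right_end size_tuple ltnn subrr.
    rewrite -(vandermonde_det (fun t => expR (- t))); congr (\det _).
    apply/matrixP => i j; rewrite !mxE /D /right_end size_tuple ltn_ord.
    rewrite primitive_dgamma ?primitive_dgammay ?chamber_ge0// opprB addrC subrK.
    by rewrite /gamma_weight powR_mulrn ?chamber_ge0// (tnth_nth 0).
  by apply/matrixP => i j; rewrite !mxE /D; ring.
- by rewrite size_tuple.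
- by apply: measurableT_comp => //; exact: measurable_funN.
- case=> [|j] t _ t0; last first.
    have := dgamma_powR 0 j t0; rewrite add0r => <-.
    by rewrite /gamma_weight powRr0 mul1r.
  rewrite mul0r subr0 mul1r /dgamma mul0r subr0.
  by rewrite /gamma_weight powRr0 mul1r.
- move=> j _; rewrite /right_end/= size_tuple ltnn.
  exact: integrable_dgamma.
Qed.

Lemma integral_interlaced_powR N (alpha : R) (z : N.-tuple R) : -1 < alpha ->
  path <=%R 0 z ->
  (\int[lamn N]_(y in [set y | interlaced (0%R :: z) y])
     (vandermonde y * \prod_i tnth y i `^ alpha)%:E =
   ((pochhammer (alpha + 1) N)^-1 *
     (vandermonde z * \prod_i tnth z i `^ (alpha + 1)))%:E)%E.
Proof.
move=> a1 pz.
have aj (j : nat) : 0 < alpha + 1 + j%:R.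
  by rewrite (@lt_le_trans _ _ (alpha + 1)) ?lerDl// -ltrBlDr sub0r.
have aj1 (j : nat) : -1 < alpha + j%:R.
  by have := aj j; rewrite addrAC -ltrBlDr sub0r.
rewrite (@integral_box_vandermonde _ _ (fun=> 0) (fun t => t `^ alpha)
  (fun j t => t `^ (alpha + j%:R)))//=.
- congr (_%:E).
  rewrite (@det_row_diff0 _ _ (fun i (j : 'I_N) =>
    primitive (fun t => t `^ (alpha + j%:R)) (right_end (0 :: z) i))); last first.
    by move=> j; rewrite /right_end/= primitive0.
  rewrite -(vandermonde_det (fun t => t `^ (alpha + 1))).
  have -> : (pochhammer (alpha + 1) N)^-1 =
      \prod_(j < N) (alpha + 1 + j%:R)^-1 by rewrite prodfV.
  have := det_scale (fun=> 1) (fun j : 'I_N => (alpha + 1 + j%:R)^-1)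
    (fun i j : 'I_N => tnth z i ^+ j * tnth z i `^ (alpha + 1)).
  rewrite [X in X * _ * _]big1// mul1r [RHS]mulrC => <-; congr (\det _).
  apply/matrixP => i j; rewrite !mxE /right_end/= ltnS size_tuple ltn_ord.
  rewrite primitive_powR ?chamber_ge0// mul1r addrAC powRDn ?chamber_ge0//.
    by rewrite (tnth_nth 0) [_ * z`_i ^+ j]mulrC.
  by rewrite -ltrBlDr sub0r.
- by rewrite lexx.
- by rewrite size_tuple leqnSn.
- move=> j t _ t0; rewrite mul0r subr0 powRD; last first.
    by rewrite (gt_eqF t0) implybT.
  by rewrite powR_mulrn ?ltW// mulrC.
- move=> j _.
  have [e|[b ->]] : right_end (0 :: z) N = +oo%O \/
      exists b, right_end (0 :: z) N = BRight b.
    by rewrite /right_end; case: ifP => _; [right; eexists|left].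
    by move: e; rewrite /right_end/= size_tuple ltnSn.
  exact: (integrable_powR b (aj1 j)).
Qed.

(** The primitives t^(j+1) / (j+1) bordered by a column of ones form a Vandermonde
    matrix in the N + 1 points of x with column j divided by max(j, 1). *)
Lemma integral_interlaced_vandermonde N (x : N.+1.-tuple R) : path <=%R 0 x ->
  (\int[lamn N]_(z in [set z | interlaced x z]) (vandermonde z)%:E =
   (vandermonde x / N`!%:R)%:E)%E.
Proof.
move=> px.
transitivity (\int[lamn N]_(z in [set z | interlaced x z])
    (vandermonde z * \prod_(i < N) 1)%:E)%E.
  by apply: eq_integral => z _; rewrite big1// mulr1.
rewrite (@integral_box_vandermonde _ _ (fun=> 0) (fun=> 1)
  (fun j t => t `^ j%:R))//=.
- congr (_%:E).
  rewrite (@det_row_diff_border _ _ (fun i j =>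
    primitive (fun t => t `^ j%:R) (right_end x i))).
  have -> : (N`!%:R)^-1 = \prod_(j < N.+1) (maxn j 1)%:R^-1 :> R.
    rewrite prodfV -natr_prod fact_prod big_ord_recl mul1n big_add1 big_mkord.
    by congr (_%:R^-1); apply: eq_bigr => i _; rewrite (maxn_idPl _).
  have -> : vandermonde x =
      \det (\matrix_(i < N.+1, j < N.+1) (tnth x i ^+ j * 1)).
    by rewrite (vandermonde_det (fun=> 1)) big1// mulr1.
  have := det_scale (fun=> 1) (fun j : 'I_N.+1 => (maxn j 1)%:R^-1 : R)
    (fun i j : 'I_N.+1 => tnth x i ^+ j * 1).
  rewrite [X in X * _ * _]big1// mul1r => <-; congr (\det _).
  apply/matrixP => i [[|j] jN]; rewrite !mxE /= ?maxn0 ?expr0 ?mul1r ?invr1//.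
  rewrite /right_end size_tuple ltn_ord primitive_powR ?chamber_ge0//; last first.
    by rewrite (lt_le_trans (ltrN10 _)).
  by rewrite natr1 powR_mulrn ?chamber_ge0// mulr1 (tnth_nth 0).
- by rewrite size_tuple.
- by move=> j t _ t0; rewrite mul0r subr0 powR_mulrn ?ltW// mulr1.
- move=> j _; rewrite /right_end/= size_tuple ltnSn; apply: integrable_powR.
  by rewrite (lt_le_trans (ltrN10 _)).
Qed.

End box_values.

(** * Tonelli for a two-step link, and integration against a density *)

Section tonelli.
Context {R : realType} d1 d2 d3 (T1 : measurableType d1)
  (T2 : measurableType d2) (T3 : measurableType d3).
Variables (m1 : {sigma_finite_measure set T1 -> \bar R})
  (m2 : {sigma_finite_measure set T2 -> \bar R})
  (m3 : {sigma_finite_measure set T3 -> \bar R}).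
Variables (p : T1 * T3 -> R) (q : T2 * T3 -> R).
Hypothesis mp : measurable_fun setT p.
Hypothesis mq : measurable_fun setT q.
Hypothesis p0 : forall u, 0 <= p u.
Hypothesis q0 : forall u, 0 <= q u.

Let mpE : measurable_fun setT (EFin \o p).
Proof. exact/measurable_EFinP. Qed.
Let mqE : measurable_fun setT (EFin \o q).
Proof. exact/measurable_EFinP. Qed.

Let mp1 x : measurable_fun setT (fun z => (p (x, z))%:E).
Proof. by apply: (measurableT_comp mpE); exact: measurable_pair1. Qed.
Let mp2 z : measurable_fun setT (fun x => (p (x, z))%:E).
Proof. by apply: (measurableT_comp mpE); exact: measurable_pair2. Qed.
Let mq1 y : measurable_fun setT (fun z => (q (y, z))%:E).
Proof. by apply: (measurableT_comp mqE); exact: measurable_pair1. Qed.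
Let mq2 z : measurable_fun setT (fun y => (q (y, z))%:E).
Proof. by apply: (measurableT_comp mqE); exact: measurable_pair2. Qed.

(** Here p and q stand for the links from x to z and from y to z. *)
Lemma tonelli_link_r (x : T1) :
  (\int[m2]_y \int[m3]_z ((p (x, z))%:E * (q (y, z))%:E) =
   \int[m3]_z ((p (x, z))%:E * \int[m2]_y (q (y, z))%:E))%E.
Proof.
rewrite (fubini_tonelli (fun u : T2 * T3 => (p (x, u.2))%:E * (q u)%:E)%E)/=.
- apply: eq_integral => z _; rewrite -ge0_integralZl ?lee_fin//.
  by move=> y _; rewrite lee_fin.
- apply: emeasurable_funM => //.
  by apply: (measurableT_comp (mp1 x)); exact: measurable_snd.
- by move=> u; rewrite mule_ge0 ?lee_fin.
Qed.

Lemma tonelli_link_l (y : T2) :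
  (\int[m1]_x \int[m3]_z ((p (x, z))%:E * (q (y, z))%:E) =
   \int[m3]_z ((q (y, z))%:E * \int[m1]_x (p (x, z))%:E))%E.
Proof.
rewrite (fubini_tonelli (fun u : T1 * T3 => (p u)%:E * (q (y, u.2))%:E)%E)/=.
- apply: eq_integral => z _; under eq_integral do rewrite muleC.
  rewrite -ge0_integralZl ?lee_fin//.
  by move=> x _; rewrite lee_fin.
- apply: emeasurable_funM => //.
  by apply: (measurableT_comp (mq1 y)); exact: measurable_snd.
- by move=> u; rewrite mule_ge0 ?lee_fin.
Qed.

Lemma measurable_tonelli_link (x : T1) : measurable_fun setT
  (fun y => \int[m3]_z ((p (x, z))%:E * (q (y, z))%:E))%E.
Proof.
apply: (measurable_fun_fubini_tonelli_F
  (fun u : T2 * T3 => (p (x, u.2))%:E * (q u)%:E)%E).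
  apply: emeasurable_funM => //.
  by apply: (measurableT_comp (mp1 x)); exact: measurable_snd.
by move=> u; rewrite mule_ge0 ?lee_fin.
Qed.

Let k (u : T1 * T2) : \bar R :=
  (\int[m3]_z ((p (u.1, z))%:E * (q (u.2, z))%:E))%E.

Let k0 u : (0 <= k u)%E.
Proof. by apply: integral_ge0 => z _; rewrite mule_ge0 ?lee_fin. Qed.

Let mk : measurable_fun setT k.
Proof.
apply: (measurable_fun_fubini_tonelli_F
  (fun w : (T1 * T2) * T3 => (p (w.1.1, w.2))%:E * (q (w.1.2, w.2))%:E)%E).
  apply: emeasurable_funM.
    apply: (measurableT_comp mpE); apply: measurable_fun_pair.
      exact: (measurableT_comp measurable_fst measurable_fst).
    exact: measurable_snd.
  apply: (measurableT_comp mqE); apply: measurable_fun_pair.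
      exact: (measurableT_comp measurable_snd measurable_fst).
    exact: measurable_snd.
by move=> w; rewrite mule_ge0 ?lee_fin.
Qed.

Variables (A : set T2) (mA : measurable A).

Let kA (u : T1 * T2) : \bar R := (k u * (\1_A u.2)%:E)%E.

Let mkA : measurable_fun setT kA.
Proof.
apply: emeasurable_funM => //; apply/measurable_EFinP.
apply: (measurableT_comp (f := \1_A : T2 -> R)); last exact: measurable_snd.
exact: measurable_indic.
Qed.

Let kAE x : (\int[m2]_(y in A) k (x, y) = \int[m2]_y kA (x, y))%E.
Proof.
rewrite integral_mkcond; apply: eq_integral => y _.
by rewrite patchE /kA indicE; case: ifP; rewrite (mule1, mule0).
Qed.

Lemma measurable_tonelli_chain : measurable_fun setT (fun x =>
  \int[m2]_(y in A) \int[m3]_z ((p (x, z))%:E * (q (y, z))%:E))%E.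
Proof.
rewrite (_ : (fun _ => _) = (fun x => \int[m2]_y kA (x, y))%E).
  apply: measurable_fun_fubini_tonelli_F => // u.
  by rewrite mule_ge0.
by apply/funext => x; rewrite -kAE.
Qed.

Lemma tonelli_chain :
  (\int[m1]_x \int[m2]_(y in A) \int[m3]_z ((p (x, z))%:E * (q (y, z))%:E) =
   \int[m2]_(y in A) \int[m3]_z ((q (y, z))%:E * \int[m1]_x (p (x, z))%:E))%E.
Proof.
transitivity (\int[m1]_x \int[m2]_y kA (x, y))%E.
  by apply: eq_integral => x _; rewrite -kAE.
rewrite fubini_tonelli//; last by move=> u; rewrite mule_ge0.
rewrite [RHS]integral_mkcond; apply: eq_integral => y _.
rewrite patchE /kA/= indicE; case: ifP => yA.
  by under eq_integral do rewrite mule1; rewrite -tonelli_link_l.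
by under eq_integral do rewrite mule0; rewrite integral0.
Qed.

End tonelli.

Section density.
Context d (T : measurableType d) {R : realType}.
Variables (mu nu : {measure set T -> \bar R}) (C : set T) (g : T -> R).
Hypothesis mC : measurable C.
Hypothesis mg : measurable_fun setT g.
Hypothesis g0 : forall x, 0 <= g x.
Hypothesis nuE : forall A, measurable A ->
  nu A = (\int[mu]_(x in A `&` C) (g x)%:E)%E.

Import HBNNSimple.

Lemma ge0_integral_density (f : T -> \bar R) (D : set T) : measurable D ->
  D `<=` C -> measurable_fun D f -> (forall x, D x -> 0 <= f x)%E ->
  (\int[nu]_(x in D) f x = \int[mu]_(x in D) (f x * (g x)%:E))%E.
Proof.
move=> mD DC mf f0.
pose h := nnsfun_approx mD mf.
have -> : (\int[nu]_(x in D) f x =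
    limn (fun n => \int[nu]_(x in D) (h n x)%:E))%E.
  rewrite -monotone_convergence//.
  - apply: eq_integral => x /set_mem Dx; apply/esym/cvg_lim => //.
    by apply: cvg_nnsfun_approx.
  - by move=> n; apply/measurable_EFinP; exact: measurable_funTS.
  - by move=> n x _; rewrite lee_fin.
  - by move=> x _ m n mn; rewrite lee_fin; exact/lefP/nd_nnsfun_approx.
have -> : (\int[mu]_(x in D) (f x * (g x)%:E) =
    limn (fun n => \int[mu]_(x in D) ((h n x)%:E * (g x)%:E)))%E.
  rewrite -monotone_convergence//.
  - apply: eq_integral => x /set_mem Dx; apply/esym/cvg_lim => //.
    by apply: cvgeZr => //; apply: cvg_nnsfun_approx.
  - move=> n; apply: emeasurable_funM; apply/measurable_EFinP.
      exact: measurable_funTS.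
    exact: measurable_funTS.
  - by move=> n x _; rewrite mule_ge0 ?lee_fin.
  - move=> x _ m n mn; rewrite lee_wpmul2r ?lee_fin//.
    exact/lefP/nd_nnsfun_approx.
congr (limn _); apply/funext => n.
apply/esym.
transitivity (\int[nu]_(x in D)
   (\sum_(y \in range (h n)) (y * \1_(h n @^-1` [set y]) x)%:E))%E; last first.
  by apply: eq_integral => t tE; rewrite /= fimfunE -fsumEFin.
have indich m r : measurable_fun D (fun x => (r * \1_(h m @^-1` [set r]) x)%:E).
  by apply: (measurable_comp measurableT) => //; exact: measurable_funM.
have mgD : measurable_fun D (EFin \o g).
  by apply/measurable_EFinP; exact: measurable_funTS.
rewrite ge0_integral_fsum//; last by move=> m y Ey; exact: nnfun_muleindic_ge0.
transitivity (\int[mu]_(x in D) (\sum_(y \in range (h n))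
    (y * \1_(h n @^-1` [set y]) x)%:E * (g x)%:E))%E.
  under [RHS]eq_integral => x xE.
    rewrite -ge0_mule_fsuml => [|y]; last exact: nnfun_muleindic_ge0.
    rewrite fsumEFin // -(fimfunE _ x); over.
  by [].
rewrite ge0_integral_fsum//; last 2 first.
  - by move=> y; apply: emeasurable_funM.
  - move=> m y Ey; apply: mule_ge0; last by rewrite lee_fin.
    exact: nnfun_muleindic_ge0.
apply: eq_fsbigr => r rhn.
under [RHS]eq_integral do rewrite EFinM.
rewrite integralZl_indic_nnsfun => //.
under eq_integral do rewrite EFinM -muleA.
have r0 : (0 <= r%:E)%E by move: rhn => /set_mem[x _ <-]; rewrite lee_fin.
rewrite ge0_integralZl//.
- under eq_integral do rewrite muleC.
  rewrite (eq_integral ((EFin \o g) \_ (h n @^-1` [set r]))); last first.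
    by move=> x xE; rewrite epatch_indic.
  rewrite -integral_mkcondr integral_indic// setIC nuE; last exact: measurableI.
  by rewrite -setIA (setIidl DC) setIC.
- by apply: emeasurable_funM => //; exact/measurable_EFinP.
- by move=> x _; rewrite mule_ge0 ?lee_fin.
Qed.

End density.

(** * The kernel as an integral over an intermediate vector *)

Section chambers.
Context {R : realType}.
Local Notation lam := (@lebesgue_measure R).
Local Notation lamn := (lebesgue_tuple R).

Lemma open_chamberE n : open_chamber n =
  chamber n `\` [set x : n.-tuple R | ~~ uniq (0 :: x)].
Proof.
apply/seteqP; split => x.
  by move=> /chamber_uniq[cx ux]; split => //; apply/negP/negPn.
by move=> [cx /negP/negPn ux]; apply/chamber_uniq.
Qed.

Lemma measurable_open_chamber n :
  measurable (open_chamber n : set (n.-tuple R)).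
Proof.
rewrite open_chamberE; apply: measurableD; first exact: measurable_chamber.
exact: (lebesgue_tuple_not_uniq n).1.
Qed.

(** D may meet the boundary of the chamber only in a null set. *)
Lemma ge0_integral_open_chamber n (D : set (n.-tuple R))
    (f : n.-tuple R -> \bar R) :
  measurable D -> D `<=` chamber n -> (forall x, D x -> 0 <= f x)%E ->
  (\int[lamn n]_(x in D) f x = \int[lamn n]_(x in D `&` open_chamber n) f x)%E.
Proof.
move=> mD Dc f0; have [mN N0] := @lebesgue_tuple_not_uniq R n.
rewrite (ge0_integral_setD_null mD mN N0 f0); congr integral.
by rewrite open_chamberE setIDA (setIidl Dc).
Qed.

Lemma vandermonde_ge0 n (x : n.-tuple R) : path <=%R 0 x -> 0 <= vandermonde x.
Proof.
move=> px; apply: prodr_ge0 => i _; apply: prodr_ge0 => j ij.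
rewrite subr_ge0 !(tnth_nth 0).
have ss := path_sorted px.
have := sorted_leq_nth (@le_trans _ R) (@le_refl _ R) 0 ss.
by apply; rewrite ?inE ?size_tuple// ltnW.
Qed.

Lemma vandermonde_gt0 n (x : n.-tuple R) : path <%R 0 x -> 0 < vandermonde x.
Proof.
move=> px; apply: prodr_gt0 => i _; apply: prodr_gt0 => j ij.
rewrite subr_gt0 !(tnth_nth 0).
have ss := path_sorted px.
have := sorted_ltn_nth (@lt_trans _ R) 0 ss.
by apply; rewrite ?inE ?size_tuple.
Qed.

Lemma open_chamber_gt0 n (s : n.-tuple R) i :
  path <%R 0 s -> (i < n)%N -> 0 < s`_i.
Proof.
move=> ps ni; have /allP h := order_path_min (@lt_trans _ R) ps.
by apply: h; rewrite mem_nth ?size_tuple.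
Qed.

Lemma open_chamberW n (s : n.-tuple R) : path <%R 0 s -> path <=%R 0 s.
Proof. by apply: sub_path => a b; exact: ltW. Qed.

Lemma measurable_vandermonde n : measurable_fun setT (@vandermonde R n).
Proof.
apply: measurable_prod => i _ /=; under eq_fun do rewrite big_mkcond/=.
apply: measurable_prod => j _; case: (i < j)%N; last exact: measurable_cst.
by apply: measurable_funB; exact: measurable_tnth.
Qed.

Lemma measurable_prod_tnth n (w : R -> R) : measurable_fun setT w ->
  measurable_fun setT (fun x : n.-tuple R => \prod_i w (tnth x i)).
Proof.
move=> mw; apply: measurable_prod => i _.
by apply: measurableT_comp => //; exact: measurable_tnth.
Qed.

Lemma measurable_interlaced n N :
  measurable [set u : n.-tuple R * N.-tuple R | interlaced u.1 u.2].
Proof.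
rewrite (_ : [set _ | _] = \bigcap_i
   (if (i < N)%N then [set u : n.-tuple R * N.-tuple R | u.1`_i <= u.2`_i] `&`
      (if (i.+1 < n)%N
       then [set u : n.-tuple R * N.-tuple R | u.2`_i <= u.1`_i.+1] else setT)
    else setT)).
  apply: bigcap_measurable => // i _; case: ifP => // _.
  have m1 j : measurable_fun setT (fun u : n.-tuple R * N.-tuple R => u.1`_j).
    by apply: (measurableT_comp (measurable_nth j)); exact: measurable_fst.
  have m2 j : measurable_fun setT (fun u : n.-tuple R * N.-tuple R => u.2`_j).
    by apply: (measurableT_comp (measurable_nth j)); exact: measurable_snd.
  apply: measurableI.
    by rewrite -[X in measurable X]setTI; exact: measurable_fun_le.
  case: ifP => // _; rewrite -[X in measurable X]setTI.
  exact: measurable_fun_le.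
apply/seteqP; split => [u /interlacedP h i _|u h].
  case: ifP => // iN; have [h1 h2] := h i iN; split => //.
  by case: ifP => // ni; apply: h2; rewrite size_tuple.
apply/interlacedP => i iN; have := h i I; rewrite iN => -[h1].
rewrite size_tuple; by case: ifP.
Qed.

(** From s_i <= t_i <= s_{i+1} <= t_{i+1}. *)
Lemma interlaced_chamber n N (s : seq R) (t : N.-tuple R) : n = size s ->
  (N <= n)%N -> path <=%R 0 s -> interlaced s t -> path <=%R 0 t.
Proof.
move=> ->{n} Ns ps /interlacedP st; apply/(pathP 0) => i; rewrite size_tuple => iN.
case: i iN => [|i] iN /=.
  have [+ _] := st 0%N iN; apply: le_trans.
  have /allP h := order_path_min (@le_trans _ R) ps.
  by apply: h; rewrite mem_nth// (leq_trans iN).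
have [_ h] := st i (ltnW iN); have [h1 _] := st i.+1 iN.
by apply: le_trans h1; apply: h; exact: leq_trans Ns.
Qed.

End chambers.

Section Lambda_formula.
Context {R : realType}.
Local Notation lam := (@lebesgue_measure R).
Local Notation lamn := (lebesgue_tuple R).

Lemma integrable_powRV (g a b c : R) : 0 < a ->
  lam.-integrable `[a, b] (EFin \o (fun t : R => c / t `^ g)).
Proof.
move=> a0; apply: continuous_compact_integrable; first exact: segment_compact.
apply: continuous_in_subspaceT => x; rewrite inE /= in_itv/= => /andP[ax _].
apply: cvgMl_tmp; under eq_fun do rewrite -powRN.
by rewrite -powRN; apply: continuous_powR_pos; exact: lt_le_trans ax.
Qed.

Lemma ecoordE n (x : n.-tuple R) k : ecoord x k.+1 =
  if (k < n)%N then (x`_k)%:E else +oo%E.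
Proof.
rewrite /ecoord /=; case: ifPn => kn.
  by rewrite (nth_map 0) ?size_tuple.
by rewrite nth_default// size_map size_tuple leqNgt.
Qed.

(** If for every k the domain of the variable z_k is nonempty then the indicators
    are 1, because x_{k-1} <= z_{k-1} <= y_k <= z_k <= x_{k+1} (and x_0 = 0 <= y_1
    when k = 1); otherwise both sides vanish. Fubini then turns the product of
    integrals into one integral. *)
Lemma Lambda_prodE (alpha : R) N (x : N.+1.-tuple R) (y : N.-tuple R) :
  path <%R 0 x -> path <=%R 0 y ->
  (\prod_(1 <= k < N.+1)
    (\1_`[Defs.coord x k.-1, Defs.coord x k.+1]%classic (Defs.coord y k) *
     \int[lebesgue_measure]_(z in [set z : R |
         (maxe (ecoord x k) (ecoord y k) <= z%:E
            <= mine (ecoord x k.+1) (ecoord y k.+1))%E])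
       (Defs.coord y k `^ alpha / z `^ (alpha + 1))))%:E =
  (\int[lamn N]_(z in [set z | interlaced x z && interlaced y z])
     (\prod_(i < N) (tnth y i `^ alpha / tnth z i `^ (alpha + 1)))%:E)%E.
Proof.
move=> px py.
pose S (i : nat) : set R := [set t | [/\ x`_i <= t, y`_i <= t, t <= x`_i.+1 &
  ((i.+1 < N)%N -> t <= y`_i.+1)]].
pose g (i : 'I_N) (t : R) := y`_i `^ alpha / t `^ (alpha + 1).
pose gS (i : 'I_N) := g i \_ (S i).
have mS i : measurable (S i : set (measurableTypeR R)).
  rewrite (_ : S i = (`[x`_i, +oo[ `&` `[y`_i, +oo[ `&` `]-oo, x`_i.+1] `&`
    (if (i.+1 < N)%N then `]-oo, y`_i.+1] else setT))%classic); last first.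
    apply/seteqP; split => t; rewrite /S /= !in_itv/= !andbT.
      by move=> [-> -> -> h]; split => //; case: ifP => // /h; rewrite /= in_itv.
    by move=> [[[-> ->] ->]]; case: ifP => //= _; rewrite in_itv/= => ->.
  by do 3?apply: measurableI => //; case: ifP.
have ig (i : 'I_N) : lam.-integrable setT (EFin \o gS i).
  rewrite -restrict_EFin.
  apply: (iffLR (integrable_mkcond _ _)); first exact: mS.
  apply: integrableS (integrable_powRV (alpha + 1) x`_i.+1 (y`_i `^ alpha)
    (open_chamber_gt0 px (ltnW (ltn_ord i)))) => //.
  by move=> t [xt _ tx _]; rewrite /= in_itv/= xt.
rewrite [RHS]integral_mkcond.
have -> : (\int[lamn N]_z
    (((fun z : N.-tuple R => (\prod_i (tnth y i `^ alpha / tnth z i `^ (alpha + 1)))%:E)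
     \_ [set z | interlaced x z && interlaced y z]) z) =
  \int[lamn N]_z (\prod_i gS i (tnth z i))%:E)%E.
  apply: eq_integral => z _; rewrite patchE; case: ifPn => [/set_mem|].
    move=> /andP[/interlacedP xz /interlacedP yz]; congr (_%:E).
    apply: eq_bigr => i _; rewrite /gS patchE mem_set /g ?[tnth y i](tnth_nth 0)//.
    have [h1 h2] := xz i (ltn_ord i); have [h3 h4] := yz i (ltn_ord i).
    move: h2 h4; rewrite !size_tuple ltnS ltn_ord => h2 h4.
    by rewrite /S /= (tnth_nth 0); split => //; exact: h2.
  rewrite notin_setE => /= h.
  have [i hi] : exists i : 'I_N, ~ S i (tnth z i).
    apply: contrapT => /forallNP hh; apply: h.
    have {}hh i (iN : (i < N)%N) : S i z`_i.
      have := hh (Ordinal iN); rewrite (tnth_nth 0) => /contrapT; exact.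
    apply/andP; split; apply/interlacedP => i iN; have [h1 h2 h3 h4] := hh i iN;
      by split => //; rewrite size_tuple.
  by rewrite (bigD1 i)//= /gS patchE memNset// mul0r.
rewrite (integral_tuple_prod ig).2; congr (_%:E).
rewrite big_add1/= big_mkord.
have ES (i : 'I_N) : [set z : R |
         (maxe (ecoord x i.+1) (ecoord y i.+1) <= z%:E
            <= mine (ecoord x i.+2) (ecoord y i.+2))%E] = S i.
  have iN := ltn_ord i; apply/seteqP; split => t; rewrite /S /=;
    rewrite !ecoordE ge_max le_min !ltnS iN (ltnW iN) !lee_fin.
    move=> /andP[/andP[-> ->] /andP[-> h]]; split => // iN1.
    by move: h; rewrite iN1 lee_fin.
  move=> [-> -> -> h] /=; case: ifPn => [/h|]; first by rewrite lee_fin.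
  by rewrite leey.
have ER (i : 'I_N) : \int[lam]_t gS i t = \int[lam]_(t in S i) g i t.
  by rewrite [RHS]Rintegral_mkcond.
have [Sn0|] := pselect (forall i : 'I_N, exists t, S i t).
  apply: eq_bigr => i _; rewrite ES ER indicE mem_set ?mul1r//=.
  rewrite in_itv /Defs.coord/=; apply/andP; split; last first.
    by have [t [_ h1 h2 _]] := Sn0 i; exact: le_trans h2.
  case: i => -[|i] iN /=; first exact: chamber_ge0.
  have [t [h1 _ _ h2]] := Sn0 (Ordinal (ltnW iN)).
  by apply: (le_trans h1); exact: h2.
move=> /existsNP[i Si]; have S0 : S i = set0.
  by rewrite -subset0 => t St; apply: Si; exists t.
rewrite (bigD1 i)//= [RHS](bigD1 i)//= ER ES S0 !Rintegral_set0.
by rewrite mulr0 !mul0r.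
Qed.

End Lambda_formula.

(** * The intertwining *)

Section assembly.
Context {R : realType} (alpha : R) (N : nat).
Hypothesis halpha : -1 < alpha.
Local Notation lam := (@lebesgue_measure R).
Local Notation lamn := (lebesgue_tuple R).

(** The constant in front of the density of the kernel. *)
Definition norm_const : R := N`!%:R * pochhammer (alpha + 1) N.

(** The Laguerre weight of x times the density of the kernel is, up to
    [norm_const], the integral over z of [upper_link (x, z)] times
    [lower_link (y, z)] when x and y are in the open chamber, see
    [Lambda_density_links]. *)
Definition upper_link (u : N.+1.-tuple R * N.-tuple R) : R :=
  \1_(open_chamber N.+1) u.1 * (interlaced u.1 u.2)%:R *
  (vandermonde u.1 * \prod_i gamma_weight alpha (tnth u.1 i)) *
  \prod_i (tnth u.2 i `^ (alpha + 1))^-1.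

Definition lower_link (u : N.-tuple R * N.-tuple R) : R :=
  \1_(open_chamber N) u.1 * (interlaced u.1 u.2)%:R *
  (vandermonde u.1 * \prod_i tnth u.1 i `^ alpha).

Lemma laguerre_weightE n (x : n.-tuple R) : laguerre_weight alpha n x =
  vandermonde x * (vandermonde x * \prod_i gamma_weight alpha (tnth x i)).
Proof.
rewrite /laguerre_weight mulrA -expr2; congr (_ * _).
rewrite /vandermonde -prodrXl; apply: eq_bigr => i _.
by rewrite -prodrXl; apply: eq_bigr => j _; rewrite -sqrrN opprB.
Qed.

Lemma measurable_interlacedR n : measurable_fun setT
  (fun u : n.-tuple R * N.-tuple R => (interlaced u.1 u.2)%:R : R).
Proof.
rewrite (_ : (fun _ => _) =
    \1_[set u : n.-tuple R * N.-tuple R | interlaced u.1 u.2]).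
  by apply: measurable_indic; exact: measurable_interlaced.
by apply/funext => u; rewrite indicE mem_setE.
Qed.

Lemma measurable_upper_link : measurable_fun setT upper_link.
Proof.
have m1 := @measurable_fst _ _ (N.+1.-tuple R) (N.-tuple R).
have m2 := @measurable_snd _ _ (N.+1.-tuple R) (N.-tuple R).
apply: measurable_funM; last first.
  apply: (measurableT_comp (f := fun z : N.-tuple R =>
    \prod_i (tnth z i `^ (alpha + 1))^-1)) => //.
  apply: (measurable_prod_tnth (w := fun t => (t `^ (alpha + 1))^-1)).
  by under eq_fun do rewrite -powRN; exact: measurable_powR.
apply: measurable_funM; first apply: measurable_funM.
- apply: (measurableT_comp
    (f := \1_(open_chamber N.+1) : N.+1.-tuple R -> R)) => //.
  by apply: measurable_indic; exact: measurable_open_chamber.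
- exact: measurable_interlacedR.
- apply: measurable_funM.
    by apply: (measurableT_comp (@measurable_vandermonde R N.+1)).
  apply: (measurableT_comp (f := fun x : N.+1.-tuple R =>
    \prod_i gamma_weight alpha (tnth x i))) => //.
  apply: (measurable_prod_tnth (w := gamma_weight alpha)).
  exact: measurable_gamma_weight.
Qed.

Lemma measurable_lower_link : measurable_fun setT lower_link.
Proof.
have m1 := @measurable_fst _ _ (N.-tuple R) (N.-tuple R).
apply: measurable_funM; first apply: measurable_funM.
- apply: (measurableT_comp (f := \1_(open_chamber N) : N.-tuple R -> R)) => //.
  by apply: measurable_indic; exact: measurable_open_chamber.
- exact: measurable_interlacedR.
- apply: measurable_funM.
    by apply: (measurableT_comp (@measurable_vandermonde R N)).
  apply: (measurableT_comp (f := fun x : N.-tuple R =>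
    \prod_i tnth x i `^ alpha)) => //.
  apply: (measurable_prod_tnth (w := fun t => t `^ alpha)).
  exact: measurable_powR.
Qed.

Lemma upper_link_ge0 u : 0 <= upper_link u.
Proof.
rewrite /upper_link indicE; case: (boolP (u.1 \in _)) => [/set_mem|]; last first.
  by rewrite !mul0r.
move=> /open_chamberW /vandermonde_ge0 v0.
apply: mulr_ge0; last by apply: prodr_ge0 => i _; rewrite invr_ge0 powR_ge0.
rewrite mul1r mulr_ge0// mulr_ge0//.
by apply: prodr_ge0 => i _; exact: gamma_weight_ge0.
Qed.

Lemma lower_link_ge0 u : 0 <= lower_link u.
Proof.
rewrite /lower_link indicE; case: (boolP (u.1 \in _)) => [/set_mem|]; last first.
  by rewrite !mul0r.
move=> /open_chamberW /vandermonde_ge0 v0.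
rewrite mul1r mulr_ge0// mulr_ge0//.
by apply: prodr_ge0 => i _; exact: powR_ge0.
Qed.

Lemma measurable_interlaced1 n (s : seq R) :
  measurable [set z : n.-tuple R | interlaced s z].
Proof.
have := @measurable_pair1 _ _ ((size s).-tuple R) (n.-tuple R) (in_tuple s).
move=> /(_ measurableT _ (@measurable_interlaced R (size s) n)).
by rewrite setTI.
Qed.

Lemma measurable_vandermonde_prod n (w : R -> R) : measurable_fun setT w ->
  measurable_fun setT
    (fun x : n.-tuple R => vandermonde x * \prod_i w (tnth x i)).
Proof.
move=> mw; apply: measurable_funM; first exact: measurable_vandermonde.
exact: measurable_prod_tnth.
Qed.

Lemma vandermonde_prod_ge0 n (w : R -> R) (x : n.-tuple R) :
  (forall t, 0 <= w t) -> path <=%R 0 x ->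
  0 <= vandermonde x * \prod_i w (tnth x i).
Proof.
by move=> w0 px; rewrite mulr_ge0 ?vandermonde_ge0// prodr_ge0.
Qed.

Lemma laguerre_weight_gt0 n (x : n.-tuple R) : path <%R 0 x ->
  0 < laguerre_weight alpha n x.
Proof.
move=> px; rewrite laguerre_weightE !mulr_gt0 ?vandermonde_gt0//.
apply: prodr_gt0 => i _; rewrite mulr_gt0 ?expR_gt0 ?powR_gt0//.
by rewrite (tnth_nth 0) open_chamber_gt0.
Qed.

Lemma Lambda_density_links (x : N.+1.-tuple R) (y : N.-tuple R) :
  path <%R 0 x -> path <%R 0 y ->
  ((Lambda_density alpha N x y)%:E =
   (norm_const / laguerre_weight alpha N.+1 x)%:E *
   \int[lamn N]_z ((upper_link (x, z))%:E * (lower_link (y, z))%:E))%E.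
Proof.
move=> px py; have py' := open_chamberW py; have px' := open_chamberW px.
(* of the two factors vandermonde x in the weight, one cancels the denominator
   of the density *)
pose c := vandermonde x * \prod_i gamma_weight alpha (tnth x i) * vandermonde y.
have c0 : 0 <= c.
  rewrite !mulr_ge0 ?vandermonde_ge0//.
  by apply: prodr_ge0 => i _; exact: gamma_weight_ge0.
have -> : (\int[lamn N]_z ((upper_link (x, z))%:E * (lower_link (y, z))%:E) =
  c%:E * \int[lamn N]_(z in [set z | interlaced x z && interlaced y z])
     (\prod_(i < N) (tnth y i `^ alpha / tnth z i `^ (alpha + 1)))%:E)%E.
  rewrite -ge0_integralZl//=.
  - rewrite [RHS]integral_mkcond; apply: eq_integral => z _.
    rewrite patchE (_ : (z \in _) = interlaced x z && interlaced y z); last first.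
      by apply/idP/idP => [/set_mem//|h]; exact/mem_set.
    rewrite /upper_link /lower_link /= !indicE !mem_set//.
    rewrite !mul1r -EFinM.
    case: (interlaced x z) => /=; last by rewrite !mul0r.
    case: (interlaced y z) => /=; last by rewrite !(mul0r, mulr0).
    rewrite -EFinM !mul1r /c; congr (_%:E).
    by rewrite [\prod_(i < N) (_ / _)]big_split /=; ring.
  - rewrite (_ : [set _ | _] = [set z : N.-tuple R | interlaced x z] `&`
        [set z | interlaced y z]).
      by apply: measurableI; exact: measurable_interlaced1.
    by apply/seteqP; split => z /=; [move=> /andP[]|move=> [-> ->]].
  - apply/measurable_EFinP; apply: measurable_funTS.
    apply: measurable_prod => i _; apply: measurable_funM => //.
    apply: (measurableT_comp (f := fun t => (t `^ (alpha + 1))^-1)).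
      by under eq_fun do rewrite -powRN; exact: measurable_powR.
    exact: measurable_tnth.
  - move=> z _; rewrite lee_fin prodr_ge0// => i _.
    by rewrite divr_ge0 ?powR_ge0.
rewrite -(Lambda_prodE alpha px py') -!EFinM /Lambda_density; congr (_%:E).
rewrite [RHS]mulrA; congr (_ * _); rewrite /c laguerre_weightE /norm_const.
have vx : vandermonde x != 0 by rewrite gt_eqF ?vandermonde_gt0.
have gx : \prod_i gamma_weight alpha (tnth x i) != 0.
  have := laguerre_weight_gt0 px; rewrite laguerre_weightE => /gt_eqF/negbT.
  by rewrite !mulf_eq0 !negb_or => /and3P[].
by field; rewrite vx gx.
Qed.

(** The box of the x interlacing with 0, z lies in the chamber, hence differs by a
    null set from its intersection with the open chamber. *)
Lemma integral_interlaced_open n (z : N.-tuple R) (phi : n.-tuple R -> R) :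
  (N <= n <= N.+1)%N -> path <=%R 0 z ->
  measurable_fun setT phi ->
  (forall x : n.-tuple R, path <=%R 0 x -> 0 <= phi x) ->
  (\int[lamn n]_x (\1_(open_chamber n) x * (interlaced x z)%:R * phi x)%:E =
   \int[lamn n]_(x in [set x | interlaced (0%R :: z) x]) (phi x)%:E)%E.
Proof.
move=> nN pz mphi phi0; have /andP[Nn nN1] := nN.
have bc : [set x : n.-tuple R | interlaced (0%R :: z) x] `<=` chamber n.
  move=> x /= xz; apply: interlaced_chamber xz => //=; last by rewrite lexx.
  by rewrite size_tuple.
rewrite [RHS]ge0_integral_open_chamber//.
- rewrite [RHS]integral_mkcond; apply: eq_integral => x _.
  rewrite patchE indicE; case: (boolP (x \in open_chamber n)) => xU; last first.
    rewrite !mul0r memNset//= => -[_]; apply: contraNnot xU; exact/mem_set.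
  have px : path <=%R 0 x by apply: open_chamberW; exact/set_mem.
  rewrite mul1r (interlacedC _ nN) ?chamber_ge0//.
  case: (boolP (interlaced _ x)) => xz.
    by rewrite mul1r mem_set//; split => //; exact/set_mem.
  by rewrite mul0r memNset//= => -[]; rewrite (negbTE xz).
- exact: measurable_interlaced1.
- by move=> x /bc; rewrite lee_fin; exact: phi0.
Qed.

Lemma integral_upper_link (z : N.-tuple R) :
  path <=%R 0 z -> (forall i, 0 < tnth z i) ->
  (\int[lamn N.+1]_x (upper_link (x, z))%:E =
   (primitive (gamma_weight alpha) +oo%O *
     (vandermonde z * \prod_i expR (- tnth z i)))%:E)%E.
Proof.
move=> pz z0; pose cz := \prod_i (tnth z i `^ (alpha + 1))^-1.
pose a (x : N.+1.-tuple R) := vandermonde x * \prod_i gamma_weight alpha (tnth x i).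
have cz0 : 0 <= cz by apply: prodr_ge0 => i _; rewrite invr_ge0 powR_ge0.
have ma : measurable_fun setT a.
  by apply: measurable_vandermonde_prod; exact: measurable_gamma_weight.
have a0 (x : N.+1.-tuple R) : path <=%R 0 x -> 0 <= a x.
  by apply: vandermonde_prod_ge0 => t; exact: gamma_weight_ge0.
transitivity (\int[lamn N.+1]_x
    (\1_(open_chamber N.+1) x * (interlaced x z)%:R * (a x * cz))%:E)%E.
  by apply: eq_integral => x _; congr (_%:E); rewrite /upper_link/= -[LHS]mulrA.
rewrite integral_interlaced_open ?leqnn ?leqnSn//=; last 2 first.
- by apply: measurable_funM.
- by move=> x px; rewrite mulr_ge0// a0.
under eq_integral do rewrite EFinM.
rewrite ge0_integralZr ?lee_fin//; last 3 first.
- exact: measurable_interlaced1.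
- by apply/measurable_EFinP; exact: measurable_funTS.
- move=> x xz; rewrite lee_fin a0//.
  apply: interlaced_chamber xz => //=; last by rewrite lexx.
  by rewrite size_tuple.
rewrite (integral_interlaced_gamma halpha pz) -EFinM -!mulrA; congr (_ * (_ * _))%:E.
rewrite /cz -big_split; apply: eq_bigr => i _ /=.
rewrite /gamma_weight mulrAC mulfV ?mul1r//.
by rewrite powR_eq0 negb_and gt_eqF.
Qed.

Lemma integral_lower_link (z : N.-tuple R) : path <=%R 0 z ->
  (\int[lamn N]_y (lower_link (y, z))%:E =
   ((pochhammer (alpha + 1) N)^-1 *
     (vandermonde z * \prod_i tnth z i `^ (alpha + 1)))%:E)%E.
Proof.
move=> pz; rewrite -integral_interlaced_powR//.
rewrite -(@integral_interlaced_open _ _ (fun y =>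
  vandermonde y * \prod_i tnth y i `^ alpha)) ?leqnn ?leqnSn//.
  apply: (measurable_vandermonde_prod (w := fun t => t `^ alpha)).
  exact: measurable_powR.
move=> x px; apply: (vandermonde_prod_ge0 (w := fun t => t `^ alpha)) => // t.
exact: powR_ge0.
Qed.

Lemma integral_lower_upper_link (y : N.-tuple R) : path <%R 0 y ->
  (\int[lamn N]_z ((lower_link (y, z))%:E *
     \int[lamn N.+1]_x (upper_link (x, z))%:E) =
   (primitive (gamma_weight alpha) +oo%O * laguerre_weight alpha N y)%:E)%E.
Proof.
move=> py; have py' := open_chamberW py.
pose b := vandermonde y * \prod_i tnth y i `^ alpha.
pose c := primitive (gamma_weight alpha) +oo%O : R.
have c0 : 0 <= c by apply: Rintegral_ge0 => t _; exact: gamma_weight_ge0.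
have b0 : 0 <= b.
  apply: (vandermonde_prod_ge0 (w := fun t => t `^ alpha)) => // t.
  exact: powR_ge0.
have yz_chamber (z : N.-tuple R) : interlaced y z -> path <=%R 0 z.
  by apply: interlaced_chamber => //; rewrite size_tuple.
transitivity (\int[lamn N]_(z in [set z | interlaced y z])
   ((b * c)%:E * (vandermonde z * \prod_i expR (- tnth z i))%:E))%E.
  rewrite [RHS]integral_mkcond; apply: eq_integral => z _.
  rewrite patchE (_ : (z \in _) = interlaced y z); last first.
    by apply/idP/idP => [/set_mem//|h]; exact/mem_set.
  rewrite /lower_link/= indicE mem_set// mul1r.
  case: ifPn => yz; last by rewrite !mul0r mul0e.
  rewrite integral_upper_link.
  - by rewrite mul1r -!EFinM; congr (_%:E); rewrite /b /c; ring.
  - exact: yz_chamber.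
  - move=> i; move/interlacedP : yz => /(_ i (ltn_ord i))[+ _].
    by rewrite (tnth_nth 0); apply: lt_le_trans; exact: open_chamber_gt0.
have bc0 : 0 <= b * c by rewrite mulr_ge0.
rewrite ge0_integralZl ?lee_fin//; last 3 first.
- exact: measurable_interlaced1.
- apply/measurable_EFinP; apply: measurable_funTS.
  apply: (measurable_vandermonde_prod (w := fun t => expR (- t))).
  by apply: measurableT_comp => //; exact: measurable_funN.
- move=> z /yz_chamber pz; rewrite lee_fin.
  by apply: (vandermonde_prod_ge0 (w := fun t => expR (- t))) => //.
rewrite (integral_interlaced_expR py') -EFinM laguerre_weightE /b -/c.
congr (_%:E).
have -> : \prod_i gamma_weight alpha (tnth y i) =
  \prod_i tnth y i `^ alpha * \prod_i expR (- tnth y i) by rewrite -big_split.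
by ring.
Qed.

(** The Markov property of the kernel, multiplied by the Laguerre weight. *)
Lemma integral_upper_lower_link (x : N.+1.-tuple R) : path <%R 0 x ->
  (\int[lamn N]_z ((upper_link (x, z))%:E *
     \int[lamn N]_y (lower_link (y, z))%:E) =
   (laguerre_weight alpha N.+1 x / norm_const)%:E)%E.
Proof.
move=> px; have px' := open_chamberW px.
pose a := vandermonde x * \prod_i gamma_weight alpha (tnth x i).
pose c := (pochhammer (alpha + 1) N)^-1.
have c0 : 0 <= c.
  rewrite invr_ge0; apply: prodr_ge0 => i _.
  by rewrite addr_ge0// -lerBlDr sub0r ltW.
have a0 : 0 <= a.
  by apply: vandermonde_prod_ge0 => // t; exact: gamma_weight_ge0.
have xz_chamber (z : N.-tuple R) : interlaced x z -> path <=%R 0 z.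
  by apply: interlaced_chamber => //; rewrite size_tuple.
transitivity (\int[lamn N]_(z in [set z | interlaced x z])
   ((a * c)%:E * (vandermonde z)%:E))%E.
  rewrite [RHS]integral_mkcond; apply: eq_integral => z _.
  rewrite patchE (_ : (z \in _) = interlaced x z); last first.
    by apply/idP/idP => [/set_mem//|h]; exact/mem_set.
  rewrite /upper_link/= indicE mem_set// mul1r.
  case: ifPn => xz; last by rewrite !mul0r mul0e.
  rewrite integral_lower_link; last exact: xz_chamber.
  rewrite mul1r -!EFinM -/a -/c; congr (_%:E).
  have z0 i : 0 < tnth z i.
    move/interlacedP : xz => /(_ i (ltn_ord i))[+ _].
    rewrite (tnth_nth 0); apply: lt_le_trans; apply: open_chamber_gt0 => //.
    exact: ltnW (ltn_ord i).
  set P := \prod_i (tnth z i `^ (alpha + 1))^-1.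
  set Q := \prod_i tnth z i `^ (alpha + 1).
  have e : P * Q = 1.
    rewrite -big_split big1//= => i _.
    by rewrite mulVf// powR_eq0 negb_and gt_eqF.
  transitivity (a * c * vandermonde z * (P * Q)); first by ring.
  by rewrite e mulr1.
have ac0 : 0 <= a * c by rewrite mulr_ge0.
rewrite ge0_integralZl ?lee_fin//; last 3 first.
- exact: measurable_interlaced1.
- apply/measurable_EFinP; apply: measurable_funTS; exact: measurable_vandermonde.
- by move=> z /xz_chamber pz; rewrite lee_fin vandermonde_ge0.
rewrite (integral_interlaced_vandermonde px') -EFinM laguerre_weightE /norm_const invfM.
by congr (_%:E); rewrite /a /c; ring.
Qed.

End assembly.

Section intertwining.
Context {R : realType} (alpha : R) (N : nat).
Hypothesis halpha : -1 < alpha.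
Local Notation lam := (@lebesgue_measure R).
Local Notation lamn := (lebesgue_tuple R).
Local Notation gamma := (primitive (gamma_weight alpha) +oo%O).
Local Notation upper_link := (@upper_link R alpha N).
Local Notation lower_link := (@lower_link R alpha N).
Local Notation norm_const := (norm_const alpha N).

Lemma gamma_gt0 : 0 < gamma.
Proof.
have ig := integrable_gamma_weight halpha.
have a1 : 0 < alpha + 1 by rewrite -ltrBlDr sub0r.
rewrite -lte_fin /primitive /Rintegral fineK; last exact: integrable_fin_num.
have mg D : measurable_fun D (EFin \o gamma_weight alpha).
  by apply/measurable_EFinP; apply: measurable_funTS; exact: measurable_gamma_weight.
(* on ]0, 1] the integrand is at least e^-1 t^alpha, of integral
   e^-1 / (alpha + 1) *)
apply: (@lt_le_trans _ _ (\int[lam]_(t in `]0%R, 1%R]) (gamma_weight alpha t)%:E)%E).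
  apply: (@lt_le_trans _ _
    (\int[lam]_(t in `]0%R, 1%R]) ((expR (-1))%:E * (t `^ alpha)%:E))%E).
    rewrite ge0_integralZl ?lee_fin ?expR_ge0//.
    - by rewrite integral_powR// mule_gt0 ?lte_fin ?expR_gt0// divr_gt0// powR_gt0.
    - exact: measurable_powR_EFin.
    - by move=> t _; rewrite lee_fin powR_ge0.
  apply: ge0_le_integral => //.
  - by move=> t _; rewrite mule_ge0 ?lee_fin ?expR_ge0 ?powR_ge0.
  - by apply: emeasurable_funM => //; exact: measurable_powR_EFin.
  - exact: mg.
  - move=> t /=; rewrite in_itv/= => /andP[_ t1].
    rewrite -EFinM lee_fin /gamma_weight mulrC ler_wpM2l ?powR_ge0//.
    by rewrite ler_expR lerN2.
apply: ge0_subset_integral => //; first exact: mg.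
  by move=> t _; rewrite lee_fin gamma_weight_ge0.
by move=> t /=; rewrite !in_itv/= => /andP[->].
Qed.

Lemma norm_const_gt0 : 0 < norm_const.
Proof.
rewrite mulr_gt0 ?ltr0n ?fact_gt0//; apply: prodr_gt0 => i _.
by rewrite ltr_wpDr// -ltrBlDr sub0r.
Qed.

Lemma measurable_laguerre_weightE n (D : set (n.-tuple R)) :
  measurable_fun D (fun x => (laguerre_weight alpha n x)%:E).
Proof.
apply/measurable_EFinP; apply: measurable_funTS.
exact: measurable_laguerre_weight.
Qed.

(** The intertwining up to normalization. *)
Lemma integral_links_weight (A : set (N.-tuple R)) : measurable A ->
  (\int[lamn N.+1]_x \int[lamn N]_(y in A) \int[lamn N]_z
     ((upper_link (x, z))%:E * (lower_link (y, z))%:E) =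
   gamma%:E *
   \int[lamn N]_(y in A `&` chamber N) (laguerre_weight alpha N y)%:E)%E.
Proof.
move=> mA; have mC := @measurable_chamber R N.
rewrite (tonelli_chain _ _ _ (@measurable_upper_link R alpha N)
  (@measurable_lower_link R alpha N) (@upper_link_ge0 _ _ _)
  (@lower_link_ge0 _ _ _) mA).
rewrite ge0_integral_open_chamber; last 3 first.
- exact: measurableI.
- exact: subIsetr.
- by move=> y _; rewrite lee_fin laguerre_weight_ge0.
have mU := @measurable_open_chamber R N.
rewrite -ge0_integralZl; last 4 first.
- by apply: measurableI; [exact: measurableI|exact: mU].
- exact: measurable_laguerre_weightE.
- by move=> y _; rewrite lee_fin laguerre_weight_ge0.
- by rewrite lee_fin ltW// gamma_gt0.
rewrite [LHS]integral_mkcond [RHS]integral_mkcond; apply: eq_integral => y _.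
rewrite !patchE !in_setI; case: (boolP (y \in open_chamber N)) => yU; last first.
  rewrite !andbF; case: ifP => // _; apply: integral0_eq => z _.
  by rewrite /lower_link/= indicE (negbTE yU) !mul0r mul0e.
have yC : y \in chamber N.
  by move: yU => /set_mem /open_chamberW yC; exact/mem_set.
rewrite yC !andbT; case: ifP => // _.
by rewrite integral_lower_upper_link//; exact/set_mem.
Qed.

(** Total mass of [integral_links_weight], computed with y and z integrated out
    before x. *)
Lemma laguerre_Z_rec :
  laguerre_Z alpha N.+1 = ((norm_const * gamma)%:E * laguerre_Z alpha N)%E.
Proof.
have C0 := norm_const_gt0.
rewrite EFinM -muleA /laguerre_Z -[chamber N]setTI -integral_links_weight//.
have mU := @measurable_open_chamber R N.+1.
rewrite ge0_integral_open_chamber//; last 2 first.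
- exact: measurable_chamber.
- by move=> y _; rewrite lee_fin laguerre_weight_ge0.
rewrite (_ : chamber N.+1 `&` _ = open_chamber N.+1); last first.
  by apply/setIidr => x /open_chamberW.
transitivity (norm_const%:E * \int[lamn N.+1]_(x in open_chamber N.+1)
   (laguerre_weight alpha N.+1 x / norm_const)%:E)%E.
  rewrite -ge0_integralZl//.
  - by apply: eq_integral => x _; rewrite -EFinM mulrC divfK ?gt_eqF.
  - apply/measurable_EFinP; apply: measurable_funM => //.
    by apply/measurable_EFinP; exact: measurable_laguerre_weightE.
  - by move=> x _; rewrite lee_fin divr_ge0 ?laguerre_weight_ge0 ?ltW.
  - by rewrite lee_fin ltW.
congr (_ * _)%E; rewrite integral_mkcond; apply: eq_integral => x _.
rewrite (tonelli_link_r _ _ (@measurable_upper_link R alpha N)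
  (@measurable_lower_link R alpha N) (@upper_link_ge0 _ _ _)
  (@lower_link_ge0 _ _ _)).
rewrite patchE; case: ifPn => xU.
  by rewrite integral_upper_lower_link//; exact/set_mem.
apply/esym/integral0_eq => z _.
by rewrite /upper_link/= indicE (negbTE xU) !mul0r mul0e.
Qed.

Lemma Lambda_density_ge0 (x : N.+1.-tuple R) (y : N.-tuple R) :
  path <=%R 0 x -> path <=%R 0 y -> 0 <= Lambda_density alpha N x y.
Proof.
move=> px py; rewrite !mulr_ge0 ?invr_ge0 ?vandermonde_ge0 ?ler0n//.
  by apply: prodr_ge0 => i _; rewrite addr_ge0// -lerBlDr sub0r ltW.
rewrite big_add1 big_mkord; apply: prodr_ge0 => k _.
rewrite mulr_ge0 ?indicE ?ler0n// Rintegral_ge0// => z _.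
by rewrite divr_ge0 ?powR_ge0.
Qed.

Lemma Lambda_openE (x : N.+1.-tuple R) (A : set (N.-tuple R)) :
  measurable A -> path <%R 0 x ->
  (Lambda_open alpha N x A = (norm_const / laguerre_weight alpha N.+1 x)%:E *
    \int[lamn N]_(y in A) \int[lamn N]_z
     ((upper_link (x, z))%:E * (lower_link (y, z))%:E))%E.
Proof.
move=> mA px; have mC := @measurable_chamber R N.
have mU := @measurable_open_chamber R N.
have w0 := laguerre_weight_gt0 alpha px.
rewrite /Lambda_open ge0_integral_open_chamber; last 3 first.
- exact: measurableI.
- exact: subIsetr.
- by move=> y [_ yC]; rewrite lee_fin Lambda_density_ge0// open_chamberW.
rewrite -ge0_integralZl//; last 3 first.
- apply: measurable_funTS; apply: measurable_tonelli_link.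
  + exact: measurable_upper_link.
  + exact: measurable_lower_link.
  + exact: upper_link_ge0.
  + exact: lower_link_ge0.
- move=> y _; apply: integral_ge0 => z _.
  by rewrite mule_ge0 ?lee_fin ?upper_link_ge0 ?lower_link_ge0.
- by rewrite lee_fin divr_ge0 ?ltW// norm_const_gt0.
rewrite [LHS]integral_mkcond [RHS]integral_mkcond; apply: eq_integral => y _.
rewrite !patchE !in_setI; case: (boolP (y \in open_chamber N)) => yU; last first.
  rewrite !andbF; case: ifP => // _; rewrite integral0_eq ?mule0// => z _.
  by rewrite /lower_link/= indicE (negbTE yU) !mul0r mule0.
have yC : y \in chamber N.
  by move: yU => /set_mem /open_chamberW yC; exact/mem_set.
rewrite yC !andbT; case: ifP => // _.
by rewrite Lambda_density_links//; exact/set_mem.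
Qed.

End intertwining.

Lemma laguerre_Z_fin (R : realType) (alpha : R) n : -1 < alpha ->
  exists2 r : R, 0 < r & laguerre_Z alpha n = r%:E.
Proof.
move=> a1; elim: n => [|n [r r0 Zr]].
  exists 1 => //; rewrite /laguerre_Z.
  rewrite [LHS](_ : _ = \int[\d_ [tuple]]_(x in chamber 0)
    (laguerre_weight alpha 0 x)%:E)%E//.
  rewrite integral_dirac//; last 2 first.
  - exact: measurable_chamber.
  - exact: measurable_laguerre_weightE.
  rewrite diracE mem_set// mul1e /laguerre_weight.
  by rewrite !big_ord0 mulr1.
exists (norm_const alpha n * primitive (gamma_weight alpha) +oo%O * r).
  by apply: mulr_gt0 => //; apply: mulr_gt0; [exact: norm_const_gt0|exact: gamma_gt0].
by rewrite laguerre_Z_rec// Zr -!EFinM.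
Qed.

Lemma laguerre_null (R : realType) (alpha : R) n :
  laguerre alpha n [set x | ~~ uniq (0 :: tval x)] = 0%E.
Proof.
have [mB B0] := @lebesgue_tuple_not_uniq R n.
have mC := @measurable_chamber R n.
rewrite /laguerre (ge0_integral_setD_null (measurableI _ _ mB mC) mB B0).
  by rewrite (_ : _ `\` _ = set0) ?integral_set0// -subset0 => x [[? _]].
move=> x _; rewrite lee_fin mulr_ge0 ?laguerre_weight_ge0// invr_ge0.
by rewrite fine_ge0// integral_ge0// => y _; rewrite lee_fin laguerre_weight_ge0.
Qed.

Theorem corollary3p8 (R : realType) (alpha : R) (N : nat) (halpha : -1 < alpha) :
  forall A : set (N.-tuple R), measurable A ->
    mul_kernel (laguerre alpha N.+1) (Lambda alpha N) A =
    laguerre alpha N A.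
Proof.
move=> A mA; have mC k := @measurable_chamber R k.
have mU k := @measurable_open_chamber R k.
have [mB B0] := @lebesgue_tuple_not_uniq R N.+1.
have [z z0 Zz] := laguerre_Z_fin N halpha.
have C0 := norm_const_gt0 N halpha; have g0 := gamma_gt0 halpha.
set C := norm_const alpha N in C0; set g := primitive (gamma_weight alpha) +oo%O in g0.
have ZS : laguerre_Z alpha N.+1 = (C * g * z)%:E.
  by rewrite laguerre_Z_rec// Zz -EFinM.
have z'0 : 0 < C * g * z by apply: mulr_gt0 => //; exact: mulr_gt0.
pose K x := (\int[lebesgue_tuple R N]_(y in A) \int[lebesgue_tuple R N]_z
     ((upper_link alpha (x, z))%:E * (lower_link alpha (y, z))%:E))%E.
have mK : measurable_fun setT K.
  apply: measurable_tonelli_chain => //.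
  + exact: measurable_upper_link.
  + exact: measurable_lower_link.
  + exact: upper_link_ge0.
  + exact: lower_link_ge0.
have K0 x : (0 <= K x)%E.
  apply: integral_ge0 => y _; apply: integral_ge0 => t _.
  by rewrite mule_ge0 ?lee_fin ?upper_link_ge0 ?lower_link_ge0.
rewrite /mul_kernel.
have lE B : laguerre alpha N.+1 B = (\int[lebesgue_tuple R N.+1]_(x in
    B `&` chamber N.+1) ((C * g * z)^-1 * laguerre_weight alpha N.+1 x)%:E)%E.
  by rewrite /laguerre ZS.
have w0 := laguerre_weight_ge0 alpha.
have Lambda0 x : chamber N.+1 x -> (0 <= Lambda alpha N x A)%E.
  move=> xC; rewrite /Lambda; case: ifP => _.
    apply: integral_ge0 => y [_ yC].
    by rewrite lee_fin; exact: Lambda_density_ge0.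
  by case: pselect => // ?; exact: measure_ge0.
rewrite (ge0_integral_setD_null (mu := laguerre alpha N.+1) (mC _) mB
  (laguerre_null _ _) Lambda0) -open_chamberE.
(* on the open chamber the kernel has an explicit density, whatever it is on the
   boundary *)
transitivity (\int[laguerre alpha N.+1]_(x in open_chamber N.+1)
    ((C / laguerre_weight alpha N.+1 x)%:E * K x))%E.
  apply: eq_integral => x /set_mem px.
  rewrite /Lambda ifT; last exact: px.
  exact: Lambda_openE.
have mw : measurable_fun setT
    (fun x => (C / laguerre_weight alpha N.+1 x)%:E).
  (* an inverse written as a real power, which is measurable *)
  rewrite (_ : (fun _ => _) =
    (fun x => (C * (laguerre_weight alpha N.+1 x `^ (-1)))%:E)).
    apply/measurable_EFinP; apply: measurable_funM => //.
    apply: (measurableT_comp (measurable_powR _)).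
    exact: measurable_laguerre_weight.
  by apply/funext => x; rewrite powR_inv1.
rewrite (@ge0_integral_density _ _ _ (lebesgue_tuple R N.+1)
  (laguerre alpha N.+1) (chamber N.+1)
  (fun x => (C * g * z)^-1 * laguerre_weight alpha N.+1 x)); first last.
- move=> x _; rewrite mule_ge0// lee_fin divr_ge0// ltW//.
- by apply: measurable_funTS; apply: emeasurable_funM.
- by move=> x /open_chamberW.
- exact: mU.
- by move=> B _; exact: lE.
- by move=> x; rewrite mulr_ge0// invr_ge0 ltW.
- by apply: measurable_funM => //; exact: measurable_laguerre_weight.
transitivity (\int[lebesgue_tuple R N.+1]_x ((g * z)^-1%:E * K x))%E.
  rewrite [LHS]integral_mkcond; apply: eq_integral => x _.
  rewrite patchE; case: ifPn => xU.
    have wx : laguerre_weight alpha N.+1 x != 0.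
      by rewrite gt_eqF// laguerre_weight_gt0//; exact/set_mem.
    rewrite muleAC -EFinM; congr (_%:E * _)%E.
    by field; rewrite wx !gt_eqF.
  rewrite /K integral0_eq ?mule0// => y _; rewrite integral0_eq// => t _.
  by rewrite /upper_link/= indicE (negbTE xU) !mul0r mul0e.
rewrite ge0_integralZl//; last by rewrite lee_fin invr_ge0 ltW// mulr_gt0.
rewrite integral_links_weight// /laguerre Zz/=.
under [RHS]eq_integral do rewrite EFinM.
rewrite ge0_integralZl//; last 4 first.
- by apply: measurableI; [|exact: mC].
- exact: measurable_laguerre_weightE.
- by move=> y _; rewrite lee_fin.
- by rewrite lee_fin invr_ge0 ltW.
rewrite muleA -EFinM -/g invfM mulrAC mulVf ?mul1r//.
by rewrite gt_eqF.
Qed.
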